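(* For an endomorphism $\varphi$ of an abelian group $A$ the following are equivalent: (MF) $\varphi$ acts by means of a multiplication on a finite index subgroup $A_0$ of $A$; (FM) $\varphi$ acts by means of a multiplication modulo a finite subgroup $A_1$ of $A$. Moreover, the endomorphisms of $A$ satisfying the equivalent properties (MF) and (FM) form a subring $$FM(A)=F(A)+QM(A)$$ of $E(A)$, which is contained in $IE(A)$ provided $A$ has finite torsion-free rank. Moreover: i) if $A$ is non-periodic, then $FM(A)/F(A)$ is naturally isomorphic to the ring $\mathbb Q^{\pi_0(A)}$, and $F(A)\cap QM(A)$ consists of the maps of type $r\oplus_\pi0$ for a finite subset $\pi$ of $\pi_0(A)$ (and $r\in\mathbb Z$); ii) if $A$ is a $p$-group, then $QM(A)=M(A)$; if moreover $A$ is unbounded, then $F(A)\cap M(A)=0$; otherwise, if $e<\infty$ and $\epsilon$ are the $p$-bound and the essential $p$-bound of $A$ respectively, there is a natural ring isomorphism $F(A)\cap M(A)\simeq p^{\epsilon}\mathbb Z/p^{e}\mathbb Z$.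
   Context: All groups are abelian, written additively. $E(A)$ is the endomorphism ring of $A$; ''periodic'' means torsion. $\varphi\in E(A)$ is inertial if $H$ has finite index in $H+\varphi(H)$ for every subgroup $H\le A$; $IE(A)$ is the ring of inertial endomorphisms. $F(A)$ is the ideal of finitary endomorphisms, i.e. those with finite image. The torsion-free rank of $A$ is the rank of $A/T(A)$, where $T(A)$ is the torsion subgroup. $\mathbb Q^\pi$ (for $\pi$ a set of primes) is the ring of rationals whose denominator in lowest terms is divisible by primes in $\pi$ only. $Q_p^*$ is the ring of $p$-adic integers and $\mathcal J=\prod_pQ_p^*$, acting componentwise on every periodic abelian group. The ring $M(A)$ of multiplications of $A$ consists of: the endomorphisms given by the action of elements of $\mathcal J$, if $A$ is periodic; the endomorphisms given by multiplication by elements of $\mathbb Q^\pi$, where $\pi$ is the set of all primes $p$ such that $A$ is $p$-divisible and has no elements of order $p$ (the largest $\pi$ for which $A$ is a $\mathbb Q^\pi$-module), if $A$ is non-periodic. ''$\varphi$ acts by means of a multiplication on $A_0$'' means $A_0$ is $\varphi$-invariant and $\varphi|_{A_0}\in M(A_0)$; ''modulo $A_1$'' means $A_1$ is $\varphi$-invariant and the induced endomorphism lies in $M(A/A_1)$. $A_p$, $A_\pi$ denote the $p$- and $\pi$-component of the torsion subgroup of $A$. $\pi_0(A)$ is the set of primes $p$ such that $A_p$ is finite and $A/A_p$ is $p$-divisible. If $\pi$ is a finite subset of $\pi_0(A)$, then $A=A_\pi\oplus C$ with $C$ a uniquely determined fully invariant subgroup which is a $\mathbb Q^\pi$-module. If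 $A$ is non-periodic, a quasi-multiplication of $A$ is an endomorphism $r\oplus_\pi m/n$ (for some such $\pi$) which is multiplication by $r\in\mathbb Z$ on $A_\pi$ and by $m/n\in\mathbb Q^\pi$ on $C$; these form the subring $QM(A)$ of $E(A)$. If $A$ is periodic, $QM(A):=M(A)$. For a bounded $p$-group $A$: the $p$-bound $e$ is the least $e$ with $p^eA=0$; the essential $p$-bound $\epsilon$ is the least $\epsilon$ such that $p^\epsilon A$ is finite. *)

(* Defs.v *)
From HB Require Import structures.
From mathcomp Require Import all_boot all_order all_algebra.
From mathcomp Require Import generic_quotient ring_quotient.
From mathcomp Require Import boolp classical_sets functions cardinality.

Set Implicit Arguments.
Unset Strict Implicit.
Unset Printing Implicit Defensive.

Import GRing.Theory.

Local Open Scope classical_set_scope.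
Local Open Scope quotient_scope.
Local Open Scope ring_scope.

(* Abelian groups are [zmodType]s and subgroups of [A] are [zmodClosed A];
   by classical logic the latter are all subgroups, although they are
   boolean-valued predicates. *)

(* The ring E(A), with pointwise addition, composition as product. *)
Definition endo (A : zmodType) := {additive A -> A}.

Section EndoRing.
Variable A : zmodType.
Implicit Types f g h : endo A.

Lemma endoP f g : (forall x, f x = g x) -> f = g.
Proof.
case: f g => [f cf] [g cg] /= /funext fg; case: _ / fg in cg *.
case: cf => [[cf]]; case: cg => [[cg]].
by rewrite (Prop_irrelevance cf cg).
Qed.

HB.instance Definition _ := gen_eqMixin (endo A).
HB.instance Definition _ := gen_choiceMixin (endo A).

Fact endo_addA : associative (fun f g => f \+ g : endo A).
Proof. by move=> f g h; apply: endoP => x /=; rewrite addrA. Qed.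
Fact endo_addC : commutative (fun f g => f \+ g : endo A).
Proof. by move=> f g; apply: endoP => x /=; rewrite addrC. Qed.
Fact endo_add0 : left_id (\0 : endo A) (fun f g => f \+ g : endo A).
Proof. by move=> f; apply: endoP => x /=; rewrite add0r. Qed.
Fact endo_addN :
  left_inverse (\0 : endo A) (fun f => \- f : endo A) (fun f g => f \+ g : endo A).
Proof. by move=> f; apply: endoP => x /=; rewrite addNr. Qed.

HB.instance Definition _ :=
  GRing.isZmodule.Build (endo A) endo_addA endo_addC endo_add0 endo_addN.

Fact endo_mulA : associative (fun f g => f \o g : endo A).
Proof. by move=> f g h; apply: endoP. Qed.
Fact endo_mul1 : left_id (idfun : endo A) (fun f g => f \o g : endo A).
Proof. by move=> f; apply: endoP. Qed.
Fact endo_mulr1 : right_id (idfun : endo A) (fun f g => f \o g : endo A).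
Proof. by move=> f; apply: endoP. Qed.
Fact endo_mulDl :
  left_distributive (fun f g => f \o g : endo A) (fun f g => f \+ g : endo A).
Proof. by move=> f g h; apply: endoP. Qed.
Fact endo_mulDr :
  right_distributive (fun f g => f \o g : endo A) (fun f g => f \+ g : endo A).
Proof. by move=> f g h; apply: endoP => x /=; rewrite raddfD. Qed.

HB.instance Definition _ := GRing.Zmodule_isPzRing.Build (endo A)
  endo_mulA endo_mul1 endo_mulr1 endo_mulDl endo_mulDr.

End EndoRing.

Notation "{ 'quot' H }" := (@Quotient.quot _ H)
  (format "{ 'quot'  H }") : type_scope.

Definition subgrp (A : zmodType) (H : zmodClosed A) := {x : A | x \in H}.

Section SubGroup.
Variables (A : zmodType) (H : zmodClosed A).
HB.instance Definition _ := SubChoice.on (subgrp H).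
HB.instance Definition _ := [SubChoice_isSubZmodule of subgrp H by <:].
End SubGroup.

(* [psi] is the restriction of [phi] to [H]; its existence says that [H] is
   [phi]-invariant. *)
Definition restriction_of (A : zmodType) (phi : endo A) (H : zmodClosed A)
  (psi : endo (subgrp H)) : Prop := forall x, val (psi x) = phi (val x).

(* [psi] is induced by [phi] on [A / H]; its existence says that [H] is
   [phi]-invariant. *)
Definition induced_by (A : zmodType) (phi : endo A) (H : zmodClosed A)
  (psi : endo {quot H}) : Prop :=
  forall x, psi (\pi_{quot H} x) = \pi_{quot H} (phi x).

(* [(H + K) / H] is finite; [H] need not be contained in [K]. *)
Definition finite_index (A : zmodType) (H : zmodClosed A) (K : set A) : Prop :=
  finite_set (\pi_{quot H} @` K).

Definition inertial (A : zmodType) : set (endo A) :=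
  [set phi | forall H : zmodClosed A,
     finite_index H [set x + phi y | x in [set` H] & y in [set` H]]].
Arguments inertial : clear implicits.

Definition finitary (A : zmodType) : {pred endo A} :=
  fun phi => `[< finite_set (range phi) >].
Arguments finitary : clear implicits.

Section Finitary.
Variable A : zmodType.
Fact finitary_zmod_closed : zmod_closed (finitary A).
Proof.
split=> [|f g]; rewrite !unfold_in.
  apply/asboolP; apply: (@sub_finite_set _ _ [set 0]); last exact: finite_set1.
  by move=> _ [x _ <-].
move=> /asboolP finf /asboolP fing; apply/asboolP.
apply: (@sub_finite_set _ _ [set x - y | x in range f & y in range g]).
  by move=> _ [x _ <-]; exists (f x); [exists x | exists (g x); [exists x|]].
exact: finite_image2.
Qed.
HB.instance Definition _ :=
  GRing.isZmodClosed.Build (endo A) (finitary A) finitary_zmod_closed.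
End Finitary.

Definition pi_number (pi : set nat) (n : nat) : Prop :=
  (0 < n)%N /\ forall p, prime p -> (p %| n)%N -> pi p.

(* The subgroup [A_pi] of the elements whose order is a [pi]-number. *)
Definition component (A : zmodType) (pi : set nat) : {pred A} :=
  fun x => `[< exists2 n, pi_number pi n & x *+ n = 0 >].
Arguments component : clear implicits.

Section Component.
Variables (A : zmodType) (pi : set nat).
Fact component_zmod_closed : zmod_closed (component A pi).
Proof.
split=> [|x y]; rewrite !unfold_in.
  apply/asboolP; exists 1%N; last by rewrite mul0rn.
  split=> // p p_pr; rewrite dvdn1 => /eqP p1; by rewrite p1 in p_pr.
move=> /asboolP[m [m0 mpi] xm] /asboolP[n [n0 npi] yn]; apply/asboolP.
exists (m * n)%N; last by rewrite mulrnBl mulrnA xm mulnC mulrnA yn !mul0rn subrr.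
split=> [|p p_pr]; first by rewrite muln_gt0 m0.
by rewrite Euclid_dvdM // => /orP[/mpi|/npi]; apply.
Qed.
HB.instance Definition _ :=
  GRing.isZmodClosed.Build A (component A pi) component_zmod_closed.
End Component.

Definition torsion (A : zmodType) : zmodClosed A := component A setT.

Definition periodic (A : zmodType) : Prop :=
  forall x : A, exists2 n, (0 < n)%N & x *+ n = 0.

Definition p_group (p : nat) (A : zmodType) : Prop :=
  forall x : A, exists n, x *+ (p ^ n) = 0.

Definition p_divisible (p : nat) (A : zmodType) : Prop :=
  forall x : A, exists y, x = y *+ p.

Definition no_p_torsion (p : nat) (A : zmodType) : Prop :=
  forall x : A, x *+ p = 0 -> x = 0.

Definition lin_indep (B : zmodType) (s : seq B) : Prop :=
  forall c : 'I_(size s) -> int, \sum_(i < size s) s`_i *~ c i = 0 -> forall i, c i = 0.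

Definition finite_rank (B : zmodType) : Prop :=
  exists n, forall s : seq B, lin_indep s -> (size s <= n)%N.

Definition finite_torsionfree_rank (A : zmodType) : Prop :=
  finite_rank {quot torsion A}.

(* The ring Q^pi, as a subset of [rat]. *)
Definition Qloc (pi : set nat) : set rat := [set q | pi_number pi `|denq q|].

(* Z_p = lim Z/p^n: [padic_res a n] is the representative in [0, p^n) of
   the class of [a] modulo [p^n]. *)
Record padic (p : nat) := Padic {
  padic_res : nat -> nat;
  _ : forall n, padic_res n = (padic_res n.+1 %% p ^ n)%N
}.

Definition padic_prod := forall p, prime p -> padic p.

(* A p-adic integer multiplies an element killed by [p^n] by its residue
   modulo [p^n]; on a periodic group this determines [phi], the group being
   the direct sum of its p-components. *)
Definition acts_padic (A : zmodType) (a : padic_prod) (phi : endo A) : Prop :=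
  forall p (p_pr : prime p) n (x : A),
    x *+ (p ^ n) = 0 -> phi x = x *+ padic_res (a p p_pr) n.

(* [A] is a Q^pi-module iff every p in [pi] acts bijectively; the module
   structure is then unique. *)
Definition Qmod_primes (A : zmodType) : set nat :=
  [set p | [/\ prime p, p_divisible p A & no_p_torsion p A]].

(* M(A). As the elements of [Qloc (Qmod_primes A)] have denominators acting
   bijectively, [phi x * denq q = x * numq q] says that [phi x] is [q x]. *)
Definition mults (A : zmodType) : set (endo A) :=
  [set phi |
     (periodic A /\ exists a : padic_prod, acts_padic a phi)
  \/ (~ periodic A /\ exists2 q, Qloc (Qmod_primes A) q &
        forall x, phi x *~ denq q = x *~ numq q)].
Arguments mults : clear implicits.

Definition pi0 (A : zmodType) : set nat :=
  [set p | [/\ prime p, finite_set [set` component A [set p]]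
             & p_divisible p {quot component A [set p]}]].

(* [C] is the fully invariant Q^pi-module with [A = A_pi (+) C]. *)
Definition pi_complement (A : zmodType) (pi : set nat) (C : zmodClosed A) : Prop :=
  [/\ forall x : A, exists y z, [/\ y \in component A pi, z \in C & x = y + z],
      forall x : A, x \in component A pi -> x \in C -> x = 0,
      forall (psi : endo A) x, x \in C -> psi x \in C
    & pi `<=` Qmod_primes (subgrp C)].

(* [phi] is the quasi-multiplication r (+)_pi q. *)
Definition quasi_mult (A : zmodType) (pi : set nat) (r : int) (q : rat)
    (phi : endo A) : Prop :=
  [/\ finite_set pi, pi `<=` pi0 A, Qloc pi q
    & exists C : zmodClosed A,
      [/\ pi_complement pi C,
          forall x, x \in component A pi -> phi x = x *~ r
        & forall x, x \in C -> phi x \in C /\ phi x *~ denq q = x *~ numq q]].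

Definition quasi_mults (A : zmodType) : set (endo A) :=
  [set phi | (periodic A /\ mults A phi)
          \/ (~ periodic A /\ exists pi r q, quasi_mult pi r q phi)].
Arguments quasi_mults : clear implicits.

Definition prop_MF (A : zmodType) (phi : endo A) : Prop :=
  exists2 A0 : zmodClosed A, finite_index A0 setT &
  exists2 psi : endo (subgrp A0), restriction_of phi psi & mults (subgrp A0) psi.

Definition prop_FM (A : zmodType) (phi : endo A) : Prop :=
  exists2 A1 : zmodClosed A, finite_set [set` A1] &
  exists2 psi : endo {quot A1}, induced_by phi psi & mults {quot A1} psi.

Definition FM_ring (A : zmodType) : set (endo A) := [set phi | prop_MF phi].
Arguments FM_ring : clear implicits.

(* [f] is an isomorphism of (possibly non-unital) rings from [S / I] onto [B],
   where [S] and [B] are subrings of [R] and [T], and [I] is an ideal of [S];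
   [S / I] is the image of [S] in the group [R / I]. *)
Definition quot_ring_iso (R T : pzRingType) (S : set R) (I : zmodClosed R)
    (B : set T) (f : {quot I} -> T) : Prop :=
  [/\ set_bij (\pi_{quot I} @` S) B f,
      forall x y, S x -> S y ->
        f (\pi_{quot I} (x + y)) = f (\pi_{quot I} x) + f (\pi_{quot I} y)
    & forall x y, S x -> S y ->
        f (\pi_{quot I} (x * y)) = f (\pi_{quot I} x) * f (\pi_{quot I} y)].

Definition bound_by (p : nat) (A : zmodType) (e : nat) : Prop :=
  forall x : A, x *+ (p ^ e) = 0.

Definition ess_bound_by (p : nat) (A : zmodType) (e : nat) : Prop :=
  finite_set (range (fun x : A => x *+ (p ^ e))).

Definition least (P : nat -> Prop) (n : nat) : Prop :=
  P n /\ forall m, P m -> (n <= m)%N.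

Definition multiples (d : int) : zmodClosed int := (dvdz d : {pred int}).

(* Main.v *)
Require Import Defs.
From HB Require Import structures.
From mathcomp Require Import all_boot all_order all_algebra.
From mathcomp Require Import generic_quotient ring_quotient.
From mathcomp Require Import boolp classical_sets functions cardinality.
From mathcomp Require Import ring.
Import GRing.Theory.
Local Open Scope classical_set_scope.
Local Open Scope quotient_scope.
Local Open Scope ring_scope.

(** A periodic group and a non-periodic one behave differently, but in both
    cases (MF) and (FM) reduce to one condition modulo finitary endomorphisms.

    Non-periodic case.  Say that [phi] has slope [q = m / d], in lowest terms,
    if [d] is a product of primes of [pi0 A] and [theta = phi *+ d - m] is
    finitary ([slope]).  If [phi] is multiplication by [q] on a finite index
    subgroup [A_0], or modulo a finite subgroup [A_1], then [theta] vanishes on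
    [A_0], or maps into [A_1], so it is finitary; and the primes dividing [d] lie
    in [pi0 A], because [A] is, up to something finite, p-divisible without
    p-torsion for each of them ([pi0_of_finite_index], [pi0_of_finite]).
    Conversely let [pi] be the set of primes dividing [d] and split
    [A = A_pi (+) C] ([exists_pi_complement]).  As [d] acts bijectively on [C],
    the subgroup [C :&: ker theta] witnesses (MF) and [A_pi + theta(A)] witnesses
    (FM) ([slope_MF], [slope_FM]), and [phi] differs from the
    quasi-multiplication [0 (+)_pi q] by a finitary endomorphism
    ([slope_quasi_mult]); here one uses that only finitely many elements of [A]
    are killed by a given product of primes of [pi0 A]
    ([pi0_finite_torsion], [finitary_divn]).

    Fractions representing two endomorphisms can be subtracted and multiplied
    with the usual formulas, whence the subring.  An element of infinite order
    shows that the slope is unique ([almost_frac_unique]); it is the isomorphism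
    of [FM(A) / F(A)] onto the ring of rationals whose denominators are
    [pi0 A]-numbers, its kernel being [F(A)] as slope [0] means finitary.

    Periodic case.  A family of p-adic integers acts on the elements killed by
    [N] as a single integer [c], found by Chinese remaindering
    ([exists_padic_cong], [acts_padic_cong]).  Thus every such family acts on all
    of [A] and preserves every subgroup, and (MF) and (FM) both say that [phi]
    differs from such an action by a finitary endomorphism ([almost_padic]).

    Inertiality.  If [phi *+ n = m + theta] then, for a subgroup [H], the coset
    of [phi (y + h *+ n)] modulo [H] depends only on [phi y] and [theta h], so it
    suffices that [H / n H] is finite ([finite_mod]).  For a prime [p] of [pi0 A]
    the torsion-free rank bounds the dimension of [H / (p H + H_p)] over the field
    with [p] elements ([pindep_size]), and [H_p] is finite.

    p-groups.  A multiplication by [p ^ g u], with [u] prime to [p], has image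
    [p ^ g A].  If [A] is unbounded this is never finite; if [A] has bound [e] it
    is finite exactly when [g] is at least the essential bound, and the
    multiplication depends on the multiplier modulo [p ^ e] only. *)

Set Implicit Arguments.
Unset Strict Implicit.

(** * Subgroups, quotients and endomorphisms from their defining properties *)

Lemma exists_subgroup (A : zmodType) (P : set A) :
  P 0 -> (forall x y, P x -> P y -> P (x - y)) ->
  exists H : zmodClosed A, forall x, (x \in H) <-> P x.
Proof.
move=> P0 PB; pose S : {pred A} := fun x => `[< P x >].
have cS : zmod_closed S.
  split=> [|x y]; rewrite !unfold_in; first exact/asboolP.
  by move=> /asboolP Px /asboolP Py; apply/asboolP/PB.
pose iS := GRing.isZmodClosed.Build A S cS.
pose H : zmodClosed A := HB.pack S iS.
exists H => x; rewrite unfold_in; split; last by move/asboolP.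
by move/asboolP.
Qed.

(** A functional additive relation is the graph of an endomorphism. *)
Lemma exists_endo (A : zmodType) (P : A -> A -> Prop) :
  (forall x, exists y, P x y) ->
  (forall x y z, P x y -> P x z -> y = z) ->
  (forall x y x' y', P x y -> P x' y' -> P (x - x') (y - y')) ->
  exists phi : endo A, forall x, P x (phi x).
Proof.
move=> Pex Pun PB; have [f Pf] := choice Pex.
have fB : zmod_morphism f.
  by move=> x y; apply: Pun (Pf _) (PB _ _ _ _ (Pf x) (Pf y)).
pose if_ := GRing.isZmodMorphism.Build A A f fB.
pose phi : endo A := HB.pack f if_.
by exists phi.
Qed.

Section EndoOps.
Variable A : zmodType.
Implicit Types (f g : endo A) (x : A).

Lemma endoDE f g x : (f + g) x = f x + g x. Proof. by []. Qed.
Lemma endoBE f g x : (f - g) x = f x - g x. Proof. by []. Qed.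
Lemma endoME f g x : (f * g) x = f (g x). Proof. by []. Qed.
Lemma endoMnE f n x : (f *+ n) x = f x *+ n.
Proof. by elim: n => [|n IH]; rewrite ?mulr0n // !mulrS endoDE IH. Qed.
Lemma endoMzE f (m : int) x : (f *~ m) x = f x *~ m.
Proof.
case: m => n; rewrite -?pmulrn ?endoMnE // NegzE !mulrNz -!pmulrn.
by rewrite -endoMnE.
Qed.
Lemma endo_intE (m : int) x : (m%:~R : endo A) x = x *~ m.
Proof. by rewrite endoMzE. Qed.

Lemma exists_restriction f (H : zmodClosed A) :
  (forall x, x \in H -> f x \in H) ->
  exists psi : endo (subgrp H), restriction_of f psi.
Proof.
move=> fH.
have [||| psi psiP] := @exists_endo (subgrp H)
    (fun u v : subgrp H => val v = f (val u)).
- by move=> x; exists (Sub (f (val x)) (fH _ (valP x))); rewrite SubK.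
- by move=> x y z yx zx; apply: val_inj; rewrite yx.
- by move=> x y x' y' yx yx'; rewrite !raddfB /= yx yx'.
by exists psi.
Qed.

Lemma eq_quotP (H : zmodClosed A) x y :
  (\pi_{quot H} x = \pi_{quot H} y) <-> (x - y \in H).
Proof. by rewrite Quotient.idealrBE; split=> [->|/eqP]. Qed.

Lemma quot_eq0P (H : zmodClosed A) x : (\pi_{quot H} x = 0) <-> (x \in H).
Proof.
have -> : 0 = \pi_{quot H} 0 :> {quot H} by rewrite raddf0.
by rewrite eq_quotP subr0.
Qed.

Lemma exists_induced f (H : zmodClosed A) :
  (forall x, x \in H -> f x \in H) ->
  exists psi : endo {quot H}, induced_by f psi.
Proof.
move=> fH.
have [||| psi psiP] := @exists_endo {quot H}
    (fun u v : {quot H} => exists2 z, u = \pi_{quot H} z & v = \pi_{quot H} (f z)).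
- by move=> x; exists (\pi_{quot H} (f (repr x))), (repr x); rewrite ?reprK.
- move=> x y z [u -> ->] [v uv ->]; apply/eq_quotP.
  by rewrite -raddfB; apply/fH/eq_quotP.
- move=> x y x' y' [u -> ->] [v -> ->]; exists (u - v); first by rewrite raddfB.
  by rewrite !raddfB.
exists psi => x; have [z /eq_quotP xz ->] := psiP (\pi_{quot H} x).
apply/esym/eq_quotP; rewrite -raddfB; exact: fH.
Qed.

End EndoOps.

(** * Finiteness *)

Lemma finitaryP (A : zmodType) (f : endo A) :
  (f \in finitary A) <-> finite_set (range f).
Proof. by rewrite unfold_in; split=> /asboolP. Qed.

(** The fibres of [f] on [S] lie in cosets of [K], so a finite [K] and a finite
    image [f @` S] bound [S]. *)
Lemma finite_set_extension (A : zmodType) (f : endo A) (S K : set A) :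
  (forall x y, S x -> S y -> f x = f y -> K (y - x)) -> finite_set K ->
  finite_set (f @` S) -> finite_set S.
Proof.
move=> SK finK finfS.
have /choice[r rP] : forall t, exists x, (f @` S) t -> S x /\ f x = t.
  by move=> t; have [[x Sx <-]|nt] := pselect ((f @` S) t); [exists x|exists 0].
apply: (@sub_finite_set _ _ [set r t + k | t in f @` S & k in K]); last first.
  exact: finite_image2.
move=> x Sx; have fx : (f @` S) (f x) by exists x.
have [Sr fr] := rP _ fx.
exists (f x) => //; exists (x - r (f x)); last by rewrite addrC subrK.
exact: SK.
Qed.

(** A subgroup of order [n] is killed by [n!] already by the pigeonhole
    principle, which spares Lagrange's theorem. *)
Lemma finite_exponent (A : zmodType) (H : set A) :
  finite_set H -> (forall x n, H x -> H (x *+ n)) ->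
  exists2 n, (0 < n)%N & forall x, H x -> x *+ n = 0.
Proof.
move=> /finite_seqP[s ->] sM; exists (size s)`!; first exact: fact_gt0.
move=> x xs; have : ~~ uniq [seq x *+ i | i <- iota 0 (size s).+1].
  apply/negP => us; have := @uniq_leq_size _ _ s us.
  rewrite size_map size_iota ltnn => le; suff: false by []; apply: le.
  by move=> _ /mapP[i _ ->]; apply: sM.
case/(uniqPn 0) => i [j [ij]]; rewrite size_map size_iota => js.
have is_ := ltn_trans ij js.
rewrite !(nth_map 0%N) ?size_iota // !nth_iota // !add0n => xij.
have xij0 : x *+ (j - i) = 0 by rewrite mulrnBr ?(ltnW ij) // xij subrr.
have /dvdnP[k ->] : (j - i %| (size s)`!)%N.
  by apply: dvdn_fact; rewrite subn_gt0 ij leq_subLR (leq_trans _ (leq_addl _ _)).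
by rewrite mulnC mulrnA xij0 mul0rn.
Qed.

Section FiniteIndex.
Variable A : zmodType.
Implicit Types H K : zmodClosed A.

Lemma finite_index_exponent H : finite_index H setT ->
  exists2 n, (0 < n)%N & forall x, x *+ n \in H.
Proof.
move=> finH; have [|n n0 nP] := @finite_exponent {quot H} _ finH.
  by move=> _ n [x _ <-]; exists (x *+ n); rewrite // raddfMn.
by exists n => // x; apply/quot_eq0P; rewrite raddfMn; apply: nP; exists x.
Qed.

(** The image of [A] in [A / H] factors through [g]. *)
Lemma finite_index_of_map (T : Type) (g : A -> T) H :
  finite_set (range g) -> (forall x y, g x = g y -> x - y \in H) ->
  finite_index H setT.
Proof.
move=> fing gH.
have /choice[r rP] : forall t : T, exists x, range g t -> g x = t.
  by move=> t; have [[x _ <-]|nt] := pselect (range g t); [exists x|exists 0].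
apply: (@sub_finite_set _ _ ((fun t => \pi_{quot H} (r t)) @` range g)); last first.
  exact: finite_image.
move=> _ [x _ <-]; exists (g x); first by exists x.
by apply/eq_quotP/gH/rP; exists x.
Qed.

Lemma finitary_of_finite_index (f : endo A) H :
  finite_index H setT -> (forall x, x \in H -> f x = 0) -> f \in finitary A.
Proof.
move=> finH fH; apply/finitaryP.
apply: (@sub_finite_set _ _ ((fun t : {quot H} => f (repr t)) @` (\pi_{quot H} @` setT))).
  move=> _ [x _ <-]; exists (\pi_{quot H} x); first by exists x.
  apply/eqP; rewrite -subr_eq0 -raddfB; apply/eqP/fH/eq_quotP.
  by rewrite reprK.
exact: finite_image.
Qed.

Lemma exists_kernel (f : endo A) :
  exists H : zmodClosed A, forall x, (x \in H) <-> f x = 0.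
Proof.
apply: exists_subgroup; first exact: raddf0.
by move=> x y fx fy; rewrite raddfB fx fy subr0.
Qed.

Lemma finitaryMl (f g : endo A) : f \in finitary A -> g * f \in finitary A.
Proof.
move=> /finitaryP fin; apply/finitaryP.
apply: sub_finite_set (finite_image g fin).
by move=> _ [x _ <-]; exists (f x) => //; exists x.
Qed.

Lemma finitaryMr (f g : endo A) : f \in finitary A -> f * g \in finitary A.
Proof.
move=> /finitaryP fin; apply/finitaryP; apply: sub_finite_set fin.
by move=> _ [x _ <-]; exists (g x).
Qed.

Lemma finitary_exponent (f : endo A) : f \in finitary A ->
  exists2 n, (0 < n)%N & forall x, f x *+ n = 0.
Proof.
move=> /finitaryP fin; have [|n n0 nP] := finite_exponent fin.
  by move=> _ n [x _ <-]; exists (x *+ n); rewrite // raddfMn.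
by exists n => // x; apply: nP; exists x.
Qed.

End FiniteIndex.

(** * Primary decomposition *)

Lemma mulrznAC (A : zmodType) (x : A) (i : int) (n : nat) :
  x *~ i *+ n = x *+ n *~ i.
Proof. by rewrite pmulrn mulrzAC -pmulrn. Qed.

Lemma mulrn_absz_eq0 (A : zmodType) (x : A) (i : int) :
  x *~ i = 0 -> x *+ `|i| = 0.
Proof.
by case: i => n; rewrite -?pmulrn // NegzE mulrNz => /eqP; rewrite oppr_eq0 => /eqP.
Qed.

Lemma mulrn_coprime_split (A : zmodType) (m n : nat) (x : A) : coprime m n ->
  exists u v : int, x = x *+ m *~ u + x *+ n *~ v.
Proof.
move=> mn; have /coprimezP[[u v] /= uv] : coprimez m n by exact: mn.
exists u, v.
by rewrite !pmulrn -!mulrzA -mulrzDr ![_%:Z * _]mulrC uv.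
Qed.

Lemma mulrn_gcd0 (A : zmodType) (m n : nat) (x : A) :
  x *+ m = 0 -> x *+ n = 0 -> x *+ gcdn m n = 0.
Proof.
have [->|m0] := posnP m; first by rewrite gcd0n.
move=> xm xn; have [u v uv _] := egcdnP n m0.
have : x *+ (u * m) = x *+ (v * n + gcdn m n) by rewrite uv.
by rewrite mulrnDr [(u * m)%N]mulnC [(v * n)%N]mulnC !mulrnA xm xn !mul0rn add0r.
Qed.

Lemma mulrz_eqmod (A : zmodType) (n : nat) (i j : int) (x : A) :
  x *+ n = 0 -> (i = j %[mod n])%Z -> x *~ i = x *~ j.
Proof.
move=> xn /eqP; rewrite eqz_mod_dvd => /dvdzP[k ij].
by apply/eqP; rewrite -subr_eq0 -mulrzBr ij mulrC mulrzA -pmulrn xn mul0rz.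
Qed.

(** An additive property of torsion elements need only be checked on primary
    elements; the clause [x *+ n = 0] keeps these inside the [n]-torsion. *)
Lemma primary_ind (A : zmodType) (P : A -> Prop) (n : nat) :
  (0 < n)%N -> P 0 -> (forall x y, P x -> P y -> P (x + y)) ->
  (forall p k x, prime p -> (p %| n)%N ->
     x *+ p ^ k = 0 -> x *+ n = 0 -> P x) ->
  forall x, x *+ n = 0 -> P x.
Proof.
move=> n0 P0 PD Pprim.
suff PP d : (0 < d)%N -> (d %| n)%N -> forall x, x *+ d = 0 -> x *+ n = 0 -> P x.
  by move=> x xn; apply: (PP n).
elim/ltn_ind: d => d IH d0 dn x xd xn.
have [d1|d1] := leqP d 1; first by
  suff -> : x = 0 by []; rewrite -xd (_ : d = 1%N) //; apply/eqP; rewrite eqn_leq d1.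
pose p := pdiv d; have pp : prime p by exact: pdiv_prime.
have pd : (p %| d)%N by exact: pdiv_dvd.
have [m pm dE] := pfactor_coprime pp d0.
set k := logn p d in dE.
have k0 : (0 < k)%N by rewrite logn_gt0 mem_primes pp d0.
have m0 : (0 < m)%N by move: d0; rewrite dE muln_gt0 => /andP[].
have [u [v ->]] : exists u v : int, x = x *+ m *~ u + x *+ (p ^ k) *~ v.
  by apply: mulrn_coprime_split; rewrite coprime_sym coprimeXl.
apply: PD.
  apply: (Pprim p k); rewrite ?(dvdn_trans pd) //.
    by rewrite mulrznAC -mulrnA -dE xd mul0rz.
  by rewrite mulrznAC mulrnAC xn mul0rn mul0rz.
apply: (IH m) => //.
- by rewrite dE ltn_Pmulr // -(expn0 p) ltn_exp2l // prime_gt1.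
- by apply: dvdn_trans dn; rewrite dE dvdn_mulr.
- by rewrite mulrznAC -mulrnA mulnC -dE xd mul0rz.
- by rewrite mulrznAC mulrnAC xn mul0rn mul0rz.
Qed.

(** * Components, and the splitting off of [A_pi] *)

Section PiNumbers.
Implicit Types (pi : set nat) (p m n : nat).

Lemma pi_number1 pi : pi_number pi 1.
Proof. by split=> // p pp; rewrite dvdn1 => /eqP p1; rewrite p1 in pp. Qed.

Lemma pi_numberM pi m n : pi_number pi m -> pi_number pi n -> pi_number pi (m * n).
Proof.
move=> [m0 mP] [n0 nP]; split; first by rewrite muln_gt0 m0.
by move=> p pp; rewrite Euclid_dvdM // => /orP[]; [apply: mP|apply: nP].
Qed.

Lemma pi_numberX pi p k : prime p -> pi p -> pi_number pi (p ^ k).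
Proof.
move=> pp pip; split=> [|q qp]; first by rewrite expn_gt0 prime_gt0.
rewrite Euclid_dvdX // => /andP[].
by rewrite dvdn_prime2 // => /eqP ->.
Qed.

Lemma pi_number_dvd pi m n : (m %| n)%N -> pi_number pi n -> pi_number pi m.
Proof.
move=> mn [n0 nP]; split; first exact: dvdn_gt0 mn.
by move=> p pp pm; apply: nP pp (dvdn_trans pm mn).
Qed.

Lemma sub_pi_number pi pi' n : pi `<=` pi' -> pi_number pi n -> pi_number pi' n.
Proof. by move=> sub [n0 nP]; split=> // p pp pn; apply/sub/nP. Qed.

Lemma pi_number_ind pi (P : nat -> Prop) : P 1%N ->
  (forall p n, prime p -> pi p -> P n -> P (p * n)%N) ->
  forall n, pi_number pi n -> P n.
Proof.
move=> P1 PM; elim/ltn_ind => n IH npi; have [n0 nP] := npi.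
have [n1|n1] := leqP n 1; first by
  suff -> : n = 1%N by []; apply/eqP; rewrite eqn_leq n1.
have pp := pdiv_prime n1; have pn := pdiv_dvd n.
rewrite -(divnK pn) mulnC; apply: PM => //; first exact: nP.
apply: IH; first by rewrite ltn_Pdiv // prime_gt1.
by apply: pi_number_dvd npi; rewrite dvdn_div.
Qed.

End PiNumbers.

Section Components.
Variable A : zmodType.
Implicit Types (x y : A) (pi : set nat) (p n : nat) (C H : zmodClosed A).

Lemma componentP pi x :
  (x \in component A pi) <-> exists2 n, pi_number pi n & x *+ n = 0.
Proof. by rewrite unfold_in; split=> /asboolP. Qed.

Lemma component_primeP p x : prime p ->
  (x \in component A [set p]) <-> exists k, x *+ (p ^ k) = 0.
Proof.
move=> pp; rewrite componentP; split=> [[n [n0 nP] xn]|[k xk]]; last first.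
  by exists (p ^ k)%N => //; apply: pi_numberX.
exists (logn p n); have [m pm nE] := pfactor_coprime pp n0.
suff m1 : m = 1%N by rewrite m1 mul1n in nE; rewrite -nE.
apply/eqP/negPn/negP => m1.
have m0 : (0 < m)%N by move: n0; rewrite nE muln_gt0 => /andP[].
have m_gt1 : (1 < m)%N by rewrite ltn_neqAle eq_sym m1.
have := nP (pdiv m) (pdiv_prime m_gt1).
rewrite {1}nE dvdn_mulr ?pdiv_dvd // => /(_ isT) mp.
have := pdiv_dvd m; rewrite mp => /(coprime_dvdr)/(_ pm).
by rewrite prime_coprime // dvdnn.
Qed.

Lemma component_endo (f : endo A) pi x :
  x \in component A pi -> f x \in component A pi.
Proof.
move=> /componentP[n npi xn]; apply/componentP; exists n => //.
by rewrite -raddfMn xn raddf0.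
Qed.

Lemma p_divisible_quotP H p :
  p_divisible p {quot H} <-> forall x, exists y t, t \in H /\ x = y *+ p + t.
Proof.
split=> divH x.
  have [y] := divH (\pi_{quot H} x); rewrite -[y]reprK -raddfMn => /eq_quotP xy.
  by exists (repr y), (x - repr y *+ p); split; rewrite // addrC subrK.
have [y [t [tH xE]]] := divH (repr x); exists (\pi_{quot H} y).
by rewrite -[x]reprK -raddfMn; apply/eq_quotP; rewrite xE addrC addKr.
Qed.

(** The factor [m] is harmless: if [u m + v p = 1], then [x] is the sum of
    [u (m x)] and of a multiple of [p]. *)
Lemma pi0_intro p : prime p -> finite_set [set` component A [set p]] ->
  (forall x, exists m y t,
     [/\ coprime p m, t \in component A [set p] & x *+ m = y *+ p + t]) ->
  pi0 A p.
Proof.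
move=> pp finp div; split=> //; apply/p_divisible_quotP => x.
have [m [y [t [pm tp xm]]]] := div x.
have [u [v ->]] := mulrn_coprime_split x pm.
exists (x *~ u + y *~ v), (t *~ v); split; first exact: rpredMz.
by rewrite xm mulrzDl mulrnDl !mulrznAC addrA.
Qed.

(** Peel off one prime [p] of [n] at a time: multiplication by [p] has its kernel
    in the finite group [A_p]. *)
Lemma pi0_finite_torsion n : pi_number (pi0 A) n -> finite_set [set x : A | x *+ n = 0].
Proof.
move: n; apply: pi_number_ind => [|p n pp [_ finp _] IH].
  by apply: (@sub_finite_set _ _ [set 0]) => // x; rewrite /= mulr1n.
apply: (@finite_set_extension A p%:R _ _ _ finp).
  move=> x y _ _; rewrite !endoMnE => xy; apply/(component_primeP _ pp); exists 1%N.
  by rewrite expn1 mulrnBl xy subrr.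
by apply: sub_finite_set IH => _ [x xn <-]; rewrite /= endoMnE -mulrnA.
Qed.

Lemma pi0_divisible pi n : pi `<=` pi0 A -> pi_number pi n ->
  forall x, exists y t, t \in component A pi /\ x = y *+ n + t.
Proof.
move=> sub; move: n; apply: pi_number_ind => [|p n pp pip IH] x.
  by exists x, 0; rewrite rpred0 addr0 mulr1n.
have [_ _ /p_divisible_quotP/(_ x)[y [t [tp ->]]]] := sub _ pip.
have [z [s [spi ->]]] := IH y; exists z, (s *+ p + t); split.
  apply: rpredD; first exact: rpredMn.
  move: tp => /(component_primeP _ pp)[k tk]; apply/componentP.
  by exists (p ^ k)%N => //; apply: pi_numberX.
by rewrite mulrnDl -mulrnA mulnC addrA.
Qed.

Section FinitePi.
Variable pi : set nat.
Hypotheses (fin_pi : finite_set pi) (sub_pi : pi `<=` pi0 A).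

(** For each [p] in [pi], [e p] is the p-adic valuation of an exponent of the
    finite group [A_p]; the product of the [p ^ e p] kills [A_pi]. *)
Lemma component_exponent :
  exists2 n, pi_number pi n & forall x, x \in component A pi -> x *+ n = 0.
Proof.
have /choice[e eP] : forall p, exists e, pi p ->
    forall x k, x *+ (p ^ k) = 0 -> x *+ (p ^ e) = 0.
  move=> p; have [pip|] := pselect (pi p); last by exists 0%N.
  have [pp finp _] := sub_pi pip.
  have [|n n0 nP] := finite_exponent finp; first by move=> x n; apply: rpredMn.
  exists (logn p n) => _ x k xk.
  have xn : x *+ n = 0 by apply/nP/(component_primeP _ pp); exists k.
  have := mulrn_gcd0 xk xn.
  have /(dvdn_pfactor _ _ pp)[j jk dE] : (gcdn (p ^ k) n %| p ^ k)%N.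
    exact: dvdn_gcdl.
  have : (p ^ j %| n)%N by rewrite -dE dvdn_gcdr.
  rewrite dE pfactor_dvdn // => /(dvdn_exp2l p)/dvdnP[i ->] xj.
  by rewrite mulnC mulrnA xj mul0rn.
have /finite_seqP[s sE] := fin_pi.
exists (\prod_(p <- s) p ^ e p)%N.
  rewrite big_seq; elim/big_ind: _ => [|m n|p ps].
  - exact: pi_number1.
  - exact: pi_numberM.
  - have pip : pi p by rewrite sE.
    by apply: pi_numberX => //; have [] := sub_pi pip.
move=> x /componentP[n [n0 nP]]; move: x.
apply: primary_ind => // [|x y xn yn|p k x pp pn xk _]; rewrite ?mul0rn //.
  by rewrite mulrnDl xn yn addr0.
have pip := nP _ pp pn; have ps : p \in s by move: pip; rewrite sE.
by rewrite (big_rem _ ps) /= mulrnA (eP p pip _ k) // mul0rn.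
Qed.

Lemma component_finite : finite_set [set` component A pi].
Proof.
have [n npi nP] := component_exponent.
by apply: sub_finite_set (pi0_finite_torsion (sub_pi_number sub_pi npi)).
Qed.

(** Let the [pi]-number [n] kill [A_pi]. Since [A = n A + A_pi], and since [x]
    lies in [A_pi] as soon as [x *+ n] does, [C = n A] is a complement of
    [A_pi]. Being of the form [n A], it is fully invariant. *)
Lemma exists_pi_complement :
  exists2 C : zmodClosed A, pi_complement pi C & finite_index C setT.
Proof.
have [n npi nP] := component_exponent.
have [||C CP] := @exists_subgroup A [set x : A | exists y, x = y *+ n].
- by exists 0; rewrite mul0rn.
- by move=> _ _ [x ->] [y ->]; exists (x - y); rewrite mulrnBl.
have split x : exists y z, [/\ y \in component A pi, z \in C & x = y + z].
  have [y [t [tpi ->]]] := pi0_divisible sub_pi npi x.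
  by exists t, (y *+ n); split; [|apply/CP; exists y|rewrite addrC].
have direct x : x \in component A pi -> x \in C -> x = 0.
  move=> /componentP[m mpi xm] /CP[y xE]; rewrite xE; apply/nP/componentP.
  by exists (n * m)%N; [apply: pi_numberM|rewrite mulrnA -xE].
exists C; first split=> //.
- by move=> psi _ /CP[y ->]; apply/CP; exists (psi y); rewrite raddfMn.
- move=> p pip; have [pp _ /p_divisible_quotP divp] := sub_pi pip.
  have ppi : pi_number pi p by rewrite -(expn1 p); apply: pi_numberX.
  split=> // [[x xC]|[x xC]].
    have [y xE] := (CP x).1 xC.
    have [z [t [tpi yE]]] := pi0_divisible sub_pi ppi y.
    have znC : z *+ n \in C by apply/CP; exists z.
    exists (Sub (z *+ n) znC); apply: val_inj; rewrite raddfMn /= xE yE.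
    by rewrite mulrnDl (nP t) // addr0 mulrnAC.
  move=> /(congr1 val); rewrite raddfMn /= => xp; apply: val_inj => /=.
  by apply: direct => //; apply/componentP; exists p.
have /choice[c cP] : forall x, exists y, y \in component A pi /\ x - y \in C.
  by move=> x; have [y [z [yp zC ->]]] := split x; exists y; rewrite addrC addKr.
apply: (@finite_index_of_map _ _ c).
  apply: sub_finite_set component_finite => _ [x _ <-]; exact: (cP x).1.
move=> x y cxy; have [_ xC] := cP x; have [_ yC] := cP y.
have -> : x - y = (x - c x) - (y - c y) by rewrite cxy opprB addrA subrK.
exact: rpredB.
Qed.

End FinitePi.
End Components.

(** * Slopes: almost rational endomorphisms *)

Section Slope.
Variable A : zmodType.
Implicit Types (f g phi psi : endo A) (x y : A) (m r : int) (n : nat) (q : rat).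

(** That [phi] is [m / n] up to finitary endomorphisms, for a fraction that need
    not be reduced: this makes differences and products easy to form. *)
Definition almost_frac phi m n : Prop :=
  pi_number (pi0 A) n /\ phi *+ n - m%:~R \in finitary A.

Definition slope phi q : Prop := almost_frac phi (numq q) `|denq q|.

Lemma almost_fracE phi m n x : (phi *+ n - m%:~R) x = phi x *+ n - x *~ m.
Proof. by rewrite endoBE endoMnE endo_intE. Qed.

(** Multiplication by [n] has a finite kernel on [A], hence on the image of
    [f]. *)
Lemma finitary_divn f n :
  pi_number (pi0 A) n -> f *+ n \in finitary A -> f \in finitary A.
Proof.
move=> /pi0_finite_torsion fin_n /finitaryP fin_fn; apply/finitaryP.
apply: (@finite_set_extension A n%:R _ _ _ fin_n).
  by move=> x y _ _; rewrite !endoMnE => xy; rewrite /= mulrnBl xy subrr.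
apply: sub_finite_set fin_fn => _ [_ [x _ <-] <-]; exists x => //.
by rewrite !endoMnE.
Qed.

Lemma almost_frac_finitary phi psi m n :
  phi - psi \in finitary A -> almost_frac phi m n -> almost_frac psi m n.
Proof.
move=> finB [npi fin]; split=> //.
have -> : psi *+ n - m%:~R = phi *+ n - m%:~R - (phi - psi) *+ n.
  by rewrite mulrnBl opprB [RHS]addrC addrA subrK.
by rewrite rpredB // rpredMn.
Qed.

(** An element of infinite order detects the ratio [m / n], because a finitary
    endomorphism has finite exponent. *)
Lemma almost_frac_unique phi m n m' n' : ~ periodic A ->
  almost_frac phi m n -> almost_frac phi m' n' -> m * n' = m' * n.
Proof.
move=> nper [_ /finitary_exponent[k k0 kP]] [_ /finitary_exponent[k' k0' kP']].
apply: contrapT => ne; apply: nper => x.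
pose z := (m * n' - m' * n) * (k * k')%N : int.
exists `|z|%N.
  by rewrite absz_gt0 mulf_neq0 ?subr_eq0 //; [apply/eqP|rewrite -lt0n muln_gt0 k0].
have kx : x *~ (m * k) = phi x *~ (n%:Z * k).
  apply/eqP; rewrite eq_sym !mulrzA -!pmulrn -subr_eq0 -mulrnBl -almost_fracE.
  exact/eqP/kP.
have kx' : x *~ (m' * k') = phi x *~ (n'%:Z * k').
  apply/eqP; rewrite eq_sym !mulrzA -!pmulrn -subr_eq0 -mulrnBl -almost_fracE.
  exact/eqP/kP'.
apply: mulrn_absz_eq0.
have -> : z = m * k * (n'%:Z * k') - m' * k' * (n%:Z * k).
  by rewrite /z PoszM; ring.
by rewrite mulrzBr mulrzA kx [X in _ - X]mulrzA kx' -!mulrzA [X in _ - _ *~ X]mulrC subrr.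
Qed.

Lemma almost_frac_int (r : int) : almost_frac (r%:~R) r 1.
Proof. by split; [exact: pi_number1|rewrite mulr1n subrr rpred0]. Qed.

Lemma almost_fracB phi psi m n m' n' : almost_frac phi m n ->
  almost_frac psi m' n' -> almost_frac (phi - psi) (m * n' - m' * n) (n * n').
Proof.
move=> [npi fin] [npi' fin']; split; first exact: pi_numberM.
have -> : (phi - psi) *+ (n * n') - (m * n' - m' * n)%:~R
    = (phi *+ n - m%:~R) *+ n' - (psi *+ n' - m'%:~R) *+ n.
  apply: endoP => x; rewrite endoBE endo_intE [in RHS]endoBE !endoMnE !almost_fracE.
  rewrite endoBE mulrzBr !mulrzA -!pmulrn !mulrnBl !opprD !opprK [in RHS]addrACA.
  by rewrite -!mulrnA [(n' * n)%N]mulnC.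
by rewrite rpredB // rpredMn.
Qed.

Lemma almost_fracM phi psi m n m' n' : almost_frac phi m n ->
  almost_frac psi m' n' -> almost_frac (phi * psi) (m * m') (n * n').
Proof.
move=> [npi fin] [npi' fin']; split; first exact: pi_numberM.
have -> : (phi * psi) *+ (n * n') - (m * m')%:~R
    = (phi *+ n) * (psi *+ n' - m'%:~R) + (phi *+ n - m%:~R) * m'%:~R.
  rewrite mulrBr mulrBl addrA subrK mulrnAl mulrnAr -mulrnA.
  by rewrite [(n' * n)%N]mulnC intrM.
by apply: rpredD; [exact: finitaryMl|exact: finitaryMr].
Qed.

(** Reducing [m / n] divides by a [pi0 A]-number [g], which [finitary_divn]
    allows. *)
Lemma slope_frac phi m n : almost_frac phi m n -> slope phi (m%:~R / n%:R).
Proof.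
move=> [npi fin]; have [n0 _] := npi.
set q := _ / _; have qE : numq q * n = m * denq q.
  apply: (@intr_inj rat); rewrite !intrM.
  have nz : n%:~R != 0 :> rat by rewrite intr_eq0 -lt0n.
  have dz : (denq q)%:~R != 0 :> rat by rewrite intr_eq0 denq_neq0.
  apply: (mulIf (invr_neq0 nz)); rewrite mulfK //.
  apply: (mulIf (invr_neq0 dz)); rewrite divq_num_den mulrAC mulfK //.
have /dvdnP[g nE] : (`|denq q| %| n)%N.
  have : (denq q %| numq q * n)%Z by rewrite qE dvdz_mull.
  by rewrite Gauss_dvdzr // coprimez_sym; apply: coprime_num_den.
have mE : m = numq q * g.
  apply: (mulIf (denq_neq0 q)); rewrite -qE nE PoszM absz_denq; ring.
split; first by apply: pi_number_dvd npi; rewrite nE dvdn_mull.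
apply: (@finitary_divn _ g); first by apply: pi_number_dvd npi; rewrite nE dvdn_mulr.
by rewrite mulrnBl -mulrnA [(_ * g)%N]mulnC -nE [X in _ - X]pmulrn -mulrzA -mE.
Qed.

End Slope.

(** * Quasi-multiplications *)

Section QuasiMult.
Variable A : zmodType.
Implicit Types (phi psi : endo A) (x y z : A) (m r : int) (n : nat) (q : rat)
  (pi : set nat) (C H : zmodClosed A).

Lemma complement_torsion_free pi C n : pi_complement pi C -> pi_number pi n ->
  forall x, x \in C -> x *+ n = 0 -> x = 0.
Proof.
move=> [_ _ _ subQ]; move: n.
apply: pi_number_ind => [|p n _ /subQ[_ _ tf] IH] x xC; first by rewrite mulr1n.
rewrite mulnC mulrnA => xnp; apply: IH => //.
have := tf (Sub (x *+ n) (rpredMn n xC)).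
by move=> /(_ (val_inj _))/(congr1 val); apply; rewrite raddfMn.
Qed.

Lemma complement_divisible pi C n : pi_complement pi C -> pi_number pi n ->
  forall x, x \in C -> exists2 y, y \in C & x = y *+ n.
Proof.
move=> [_ _ _ subQ]; move: n.
apply: pi_number_ind => [|p n _ /subQ[_ dv _] IH] x xC.
  by exists x; rewrite ?mulr1n.
have [[y yC] /(congr1 val)] := dv (Sub x xC); rewrite raddfMn /= => ->.
by have [z zC ->] := IH y yC; exists z; rewrite // -mulrnA mulnC.
Qed.

Lemma complement_split pi C : pi_complement pi C -> pi `<=` pi0 A ->
  forall y y' z z', y \in component A pi -> y' \in component A pi ->
  z \in C -> z' \in C -> y + z = y' + z' -> y = y' /\ z = z'.
Proof.
move=> [_ direct _ _] sub y y' z z' yp yp' zC zC' e.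
have yy' : y - y' = z' - z.
  by apply/eqP; rewrite subr_eq addrAC eq_sym subr_eq addrC e.
have y0 : y - y' = 0 by apply: direct; [exact: rpredB|rewrite yy' rpredB].
have yE : y = y' by apply/eqP; rewrite -subr_eq0 y0.
by split=> //; apply: (@addrI _ y); rewrite e yE.
Qed.

(** On [C] the denominator of [q] acts bijectively, so the relation
    [z' *~ denq q = z *~ numq q] is the graph of the multiplication by [q]. *)
Lemma exists_quasi_mult pi r q : finite_set pi -> pi `<=` pi0 A -> Qloc pi q ->
  exists phi, quasi_mult pi r q phi.
Proof.
move=> fin_pi sub qpi; have [C CP _] := exists_pi_complement fin_pi sub.
have [split_ _ _ _] := CP.
have dE z : z *~ denq q = z *+ `|denq q| by rewrite pmulrn absz_denq.
have [||| phi phiP] := @exists_endo A (fun x w => exists y z z',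
   [/\ y \in component A pi, z \in C, z' \in C,
       z' *~ denq q = z *~ numq q & x = y + z /\ w = y *~ r + z']).
- move=> x; have [y [z [yp zC ->]]] := split_ x.
  have [z' zC' zE] := complement_divisible CP qpi (rpredMz (numq q) zC).
  by exists (y *~ r + z'), y, z, z'; split; rewrite // dE.
- move=> x w w' [y [z [z' [yp zC zC' zE [-> ->]]]]].
  move=> [u [v [v' [up vC vC' vE [e ->]]]]].
  have [yE zvE] := complement_split CP sub yp up zC vC e.
  congr (_ *~ r + _) => //; apply/eqP; rewrite -subr_eq0; apply/eqP.
  apply: (complement_torsion_free CP qpi); first exact: rpredB.
  by rewrite mulrnBl -!dE zE vE zvE subrr.
- move=> x w x' w' [y [z [z' [yp zC zC' zE [-> ->]]]]].
  move=> [u [v [v' [up vC vC' vE [-> ->]]]]].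
  exists (y - u), (z - v), (z' - v').
  split; rewrite ?rpredB // ?mulrzBl ?zE ?vE //.
  by split; rewrite !opprD addrACA.
exists phi; split=> //; exists C; split=> // x xP.
  have [y [z [z' [yp zC zC' zE [xE ->]]]]] := phiP x.
  have [|<- z0] := complement_split CP sub xP yp (rpred0 _) zC.
    by rewrite addr0.
  rewrite -z0 mul0rz in zE.
  rewrite (complement_torsion_free CP qpi zC') ?addr0 //; by rewrite -dE.
have [y [z [z' [yp zC zC' zE [xE ->]]]]] := phiP x.
have [|y0 xz] := complement_split CP sub (rpred0 _) yp xP zC.
  by rewrite add0r.
by rewrite -y0 mul0rz add0r zE xz.
Qed.

Lemma quasi_mult_slope pi r q phi : quasi_mult pi r q phi -> slope phi q.
Proof.
move=> [fin_pi sub qpi [C [[split_ _ _ _] phi_pi phiC]]].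
split; first exact: sub_pi_number sub qpi.
apply/finitaryP; set f := _ - _.
apply: sub_finite_set (finite_image f (component_finite fin_pi sub)).
move=> _ [x _ <-]; have [y [z [yp zC ->]]] := split_ x; exists y => //.
rewrite raddfD [X in _ = _ + X]almost_fracE [phi z *+ _]pmulrn absz_denq.
by rewrite (phiC z zC).2 subrr addr0.
Qed.

(** Both [phi] and [psi] have slope [q], so [(phi - psi) *+ denq q] is finitary,
    and the denominator can be cancelled. *)
Lemma slope_quasi_mult phi q : slope phi q ->
  exists pi psi, quasi_mult pi 0 q psi /\ phi - psi \in finitary A.
Proof.
move=> phiq; have [qpi0 fin] := phiq; have [d0 _] := qpi0.
pose pi : set nat := [set p | p \in primes `|denq q|%N].
have sub : pi `<=` pi0 A.
  by move=> p; rewrite /pi /= mem_primes => /and3P[pp _]; apply: (qpi0.2).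
have qpi : Qloc pi q.
  by split=> // p pp pd; rewrite /pi /= mem_primes pp d0.
have [psi psiP] := exists_quasi_mult 0 (finite_seq _) sub qpi.
exists pi, psi; split=> //.
apply: (finitary_divn qpi0); have [_ fin'] := quasi_mult_slope psiP.
rewrite mulrnBl.
have -> : phi *+ `|denq q| - psi *+ `|denq q| =
    phi *+ `|denq q| - (numq q)%:~R - (psi *+ `|denq q| - (numq q)%:~R).
  by rewrite opprB addrA subrK.
exact: rpredB.
Qed.

Lemma quasi_mult0_finitary pi r phi : quasi_mult pi r 0 phi -> phi \in finitary A.
Proof.
move=> /quasi_mult_slope[_]; rewrite /= mulr1n subr0; exact.
Qed.

Lemma periodic_of_subgrp H : finite_index H setT ->
  periodic (subgrp H) -> periodic A.
Proof.
move=> /finite_index_exponent[n n0 nP] perH x.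
have [m m0 /(congr1 val)] := perH (Sub (x *+ n) (nP x)).
rewrite raddfMn /= -mulrnA => xnm; exists (n * m)%N => //.
by rewrite muln_gt0 n0.
Qed.

Lemma periodic_of_quot H : finite_set [set` H] ->
  periodic {quot H} -> periodic A.
Proof.
move=> finH perH x.
have [|n n0 nP] := finite_exponent finH; first by move=> y n; apply: rpredMn.
have [m m0] := perH (\pi_{quot H} x); rewrite -raddfMn => /quot_eq0P xm.
by exists (m * n)%N; [rewrite muln_gt0 m0|rewrite mulrnA; apply: nP].
Qed.

(** * (MF) and (FM) for non-periodic groups *)

(** As [H] has no p-torsion, [A_p] embeds in the finite group [A / H]. If
    [n = m p ^ k], with [m] prime to [p], is an exponent of [A / H], then
    [x *+ n] is [a *+ p ^ k] for some [a] in [H], and [x *+ m] differs from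
    [a], which is divisible by [p], by an element of [A_p]. *)
Lemma pi0_of_finite_index H p : finite_index H setT ->
  Qmod_primes (subgrp H) p -> pi0 A p.
Proof.
move=> finH [pp divH tfH].
have tf x k : x \in H -> x *+ (p ^ k) = 0 -> x = 0.
  elim: k x => [|k IH] x xH; rewrite ?mulr1n // expnSr mulrnA => xk.
  apply: IH => //; have := tfH (Sub (x *+ (p ^ k)) (rpredMn _ xH)).
  by move=> /(_ (val_inj _))/(congr1 val); apply; rewrite raddfMn.
apply: pi0_intro => //.
  have fin0 : finite_set [set x : A | x \in H /\ x \in component A [set p]].
    apply: (@sub_finite_set _ _ [set 0]) => // x [xH /(component_primeP _ pp)[k]].
    exact: tf.
  have /choice[c cP] : forall t : {quot H}, exists x,
      (exists2 y, y \in component A [set p] & \pi y = t) ->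
      x \in component A [set p] /\ \pi x = t.
    move=> t; have [[x xp xt]|nt] := pselect (exists2 y, y \in component A [set p] & \pi y = t).
      by exists x.
    by exists 0.
  apply: sub_finite_set (finite_image c finH) => x xp.
  exists (\pi x); first by exists x.
  have [cp /eq_quotP cx] := cP (\pi x) (ex_intro2 _ _ x xp erefl).
  have /(component_primeP _ pp)[k ck] := rpredB cp xp.
  by apply/eqP; rewrite -subr_eq0; apply/eqP/(tf _ k).
move=> x; have [n n0 /(_ x) xn] := finite_index_exponent finH.
have [m pm nE] := pfactor_coprime pp n0; set k := logn p n in nE.
have divHk j : forall a, a \in H -> exists2 b, b \in H & a = b *+ (p ^ j).
  elim: j => [|j IH] a aH; first by exists a; rewrite ?mulr1n.
  have [[b bH] /(congr1 val)] := divH (Sub a aH); rewrite raddfMn /= => ->.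
  by have [c cH ->] := IH b bH; exists c; rewrite // -mulrnA expnSr.
have [a aH aE] := divHk k _ xn.
have [b bH bE] := divHk 1 _ aH.
exists m, b, (x *+ m - a); split=> //; last by rewrite {1}bE addrC subrK.
apply/(component_primeP _ pp); exists k.
by rewrite mulrnBl -mulrnA -nE aE subrr.
Qed.

(** As [A / H] has no p-torsion, [A_p] lies in [H]. For [t] in [H], a multiple
    [t *+ m] with [m] prime to [p] lies in [A_p]. *)
Lemma pi0_of_finite H p : finite_set [set` H] ->
  Qmod_primes {quot H} p -> pi0 A p.
Proof.
move=> finH [pp /p_divisible_quotP divH tfH].
apply: pi0_intro => //.
  apply: sub_finite_set finH => x /= /(component_primeP _ pp)[k xk].
  apply/quot_eq0P; have : (\pi_{quot H} x) *+ (p ^ k) = 0.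
    by rewrite -raddfMn xk raddf0.
  elim: k {xk} => [|k IH]; rewrite ?mulr1n // expnSr mulrnA => /tfH; exact: IH.
move=> x; have [y [t [tH ->]]] := divH x.
have [|n n0 /(_ t tH) tn] := finite_exponent finH; first by move=> z n; apply: rpredMn.
have [m pm nE] := pfactor_coprime pp n0.
exists m, (y *+ m), (t *+ m); split=> //.
  by apply/(component_primeP _ pp); exists (logn p n); rewrite -mulrnA -nE.
by rewrite mulrnDl mulrnAC.
Qed.

Lemma slope_of_MF phi : ~ periodic A -> prop_MF phi -> exists q, slope phi q.
Proof.
move=> nper [H finH [psi psiP [[perH _]|[_ [q qH psiq]]]]].
  by have := nper (periodic_of_subgrp finH perH).
exists q; split.
  by have [d0 dP] := qH; split=> // p pp /(dP _ pp); apply: pi0_of_finite_index.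
apply: (finitary_of_finite_index finH) => x xH.
have /(congr1 val) := psiq (Sub x xH).
have valMz (u : subgrp H) i : val (u *~ i) = val u *~ i by exact: raddfMz.
rewrite !valMz psiP almost_fracE SubK => e.
by apply/eqP; rewrite subr_eq0 -e pmulrn absz_denq.
Qed.

Lemma slope_of_FM phi : ~ periodic A -> prop_FM phi -> exists q, slope phi q.
Proof.
move=> nper [H finH [psi psiP [[perH _]|[_ [q qH psiq]]]]].
  by have := nper (periodic_of_quot finH perH).
exists q; split.
  by have [d0 dP] := qH; split=> // p pp /(dP _ pp); apply: pi0_of_finite.
apply/finitaryP; apply: sub_finite_set finH => _ [x _ <-].
have := psiq (\pi_{quot H} x); rewrite psiP -!raddfMz => /eq_quotP xH.
by rewrite almost_fracE pmulrn absz_denq -raddfMz.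
Qed.

End QuasiMult.

Section SlopeToMFFM.
Variable A : zmodType.
Implicit Types (phi : endo A) (x y z : A) (q : rat) (H C : zmodClosed A).

(** The finitary defect of [phi] from being [q]; a polynomial in [phi], it
    commutes with [phi]. *)
Lemma slope_theta phi q : slope phi q -> exists theta : endo A,
  [/\ theta \in finitary A, forall x, theta x = phi x *~ denq q - x *~ numq q
    & forall x, theta (phi x) = phi (theta x)].
Proof.
move=> [_ fin]; set theta := _ - _ in fin.
have thetaE x : theta x = phi x *~ denq q - x *~ numq q.
  by rewrite almost_fracE pmulrn absz_denq.
by exists theta; split=> // x; rewrite !thetaE raddfB !raddfMz.
Qed.

Lemma slope_complement phi q : slope phi q ->
  exists pi C, [/\ pi_complement pi C, finite_index C setT, Qloc pi q,
    finite_set [set` component A pi] & pi `<=` pi0 A].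
Proof.
move=> /slope_quasi_mult[pi [psi [[fin_pi sub qpi _] _]]].
have [C CP finC] := exists_pi_complement fin_pi sub.
by exists pi, C; split=> //; apply: component_finite.
Qed.

(** On the kernel of [theta] in [C] the map [phi] is multiplication by [q]. As
    [theta] maps [C] to itself and [C] has no [pi]-torsion, this kernel is still
    [pi]-divisible. *)
Lemma slope_MF phi q : ~ periodic A -> slope phi q -> prop_MF phi.
Proof.
move=> nper phiq; have [pi [C [CP finC qpi _ _]]] := slope_complement phiq.
have [_ _ Cfull subQ] := CP.
have [theta [fin thetaE theta_phi]] := slope_theta phiq.
have [||H HP] := @exists_subgroup A [set x : A | x \in C /\ theta x = 0].
- by split; [exact: rpred0|exact: raddf0].
- move=> x y [xC tx] [yC ty]; split; first exact: rpredB.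
  by rewrite raddfB tx ty subrr.
have finH : finite_index H setT.
  apply: (@finite_index_of_map _ _ (fun x => (\pi_{quot C} x, theta x))).
    apply: sub_finite_set (finite_setX finC ((finitaryP theta).1 fin)).
    by move=> _ [x _ <-]; split; exists x.
  by move=> x y [/eq_quotP xyC txy]; apply/HP; split; rewrite // raddfB txy subrr.
have phiH x : x \in H -> phi x \in H.
  move=> /HP[xC tx]; apply/HP; split; first exact: Cfull.
  by rewrite theta_phi tx raddf0.
have [psi psiP] := exists_restriction phiH.
exists H => //; exists psi => //; right; split.
  by move=> perH; apply: nper (periodic_of_subgrp finH perH).
have valMz (u : subgrp H) i : val (u *~ i) = val u *~ i by exact: raddfMz.
exists q.
  split; first by case: qpi.
  move=> p pp /(qpi.2 _ pp) pip; have [_ _ tfC] := subQ _ pip.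
  have ppi : pi_number pi p by rewrite -(expn1 p); apply: pi_numberX.
  split=> // [[x xH]|[x xH] /(congr1 val)].
    have /HP[xC tx] := xH; have [y yC yE] := complement_divisible CP ppi xC.
    have yH : y \in H.
      apply/HP; split=> //; apply: (complement_torsion_free CP ppi).
        exact: Cfull.
      by rewrite -raddfMn -yE.
    by exists (Sub y yH); apply: val_inj; rewrite raddfMn.
  rewrite raddfMn /= => xp; apply: val_inj; have /HP[xC _] := xH.
  exact: complement_torsion_free CP ppi x xC xp.
move=> u; apply: val_inj; rewrite !valMz psiP; have /HP[_ tu] := valP u.
by apply/eqP; rewrite -subr_eq0 -thetaE tu.
Qed.

(** Modulo the finite subgroup [A_pi + theta(A)] the map [phi] is multiplication
    by [q]; there is no [pi]-torsion left because a relation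
    [p c = theta(c')], with [c] and [c'] in [C], can be divided by [p]. *)
Lemma slope_FM phi q : ~ periodic A -> slope phi q -> prop_FM phi.
Proof.
move=> nper phiq; have [pi [C [CP finC qpi fin_pi sub]]] := slope_complement phiq.
have [Csplit Cdirect Cfull subQ] := CP.
have [theta [fin thetaE theta_phi]] := slope_theta phiq.
have [||H HP] := @exists_subgroup A
    [set x : A | exists t y, t \in component A pi /\ x = t + theta y].
- by exists 0, 0; split; rewrite ?rpred0 // raddf0 addr0.
- move=> _ _ [t [y [tp ->]]] [s [z [sp ->]]]; exists (t - s), (y - z).
  by split; rewrite ?rpredB // raddfB opprD addrACA.
have thetaH x : theta x \in H.
  by apply/HP; exists 0, x; split; rewrite ?rpred0 // add0r.
have compH x : x \in component A pi -> x \in H.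
  by move=> xp; apply/HP; exists x, 0; split; rewrite // raddf0 addr0.
have finH : finite_set [set` H].
  apply: sub_finite_set (finite_image2 (fun x y => x + y) fin_pi
                           ((finitaryP theta).1 fin)).
  by move=> x /HP[t [y [tp ->]]]; exists t => //; exists (theta y) => //; exists y.
have phiH x : x \in H -> phi x \in H.
  move=> /HP[t [y [tp ->]]]; apply/HP; exists (phi t), (phi y).
  by split; rewrite ?component_endo // raddfD theta_phi.
have [psi psiP] := exists_induced phiH.
exists H => //; exists psi => //; right; split.
  by move=> perH; apply: nper (periodic_of_quot finH perH).
exists q.
  split; first by case: qpi.
  move=> p pp /(qpi.2 _ pp) pip.
  have ppi : pi_number pi p by rewrite -(expn1 p); apply: pi_numberX.
  split=> //.
    apply/p_divisible_quotP => x; have [t [c [tp cC ->]]] := Csplit x.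
    have [c' _ ->] := complement_divisible CP ppi cC.
    by exists c', t; rewrite compH // addrC.
  move=> x; rewrite -[x]reprK -raddfMn => /quot_eq0P xp; apply/quot_eq0P.
  have [t [c [tp cC xE]]] := Csplit (repr x); rewrite xE in xp *.
  move: xp; rewrite mulrnDl => /HP[s [y [sp yE]]].
  have [u [c' [up cC' y2]]] := Csplit y.
  have [_ cE] : t *+ p = s + theta u /\ c *+ p = theta c'.
    apply: (complement_split CP sub); rewrite ?rpredMn ?rpredD ?component_endo //.
      exact: Cfull.
    by rewrite yE y2 raddfD addrA.
  have [c2 cC2 c2E] := complement_divisible CP ppi cC'.
  have -> : c = theta c2.
    apply/eqP; rewrite -subr_eq0; apply/eqP.
    apply: (complement_torsion_free CP ppi); first by rewrite rpredB ?Cfull.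
    by rewrite mulrnBl cE c2E raddfMn subrr.
  by apply: rpredD; [exact: compH|exact: thetaH].
move=> x; rewrite -[x]reprK psiP -!raddfMz; apply/eq_quotP.
by rewrite raddfMz -thetaE.
Qed.

End SlopeToMFFM.

(** * Periodic groups: the action of the p-adic integers *)

Section Padic.

Lemma padic_res_le p (a : padic p) j k : (j <= k)%N ->
  (padic_res a k = padic_res a j %[mod p ^ j])%N.
Proof.
move=> /subnK <-; elim: (k - j)%N => [//|i IH].
rewrite -{}IH addSn; case: a => r rP /=; rewrite [r (i + j)%N]rP.
by rewrite modn_dvdm // dvdn_exp2l // leq_addl.
Qed.

Lemma modz_dvdm (d e m : int) : (d %| e)%Z -> ((m %% e)%Z = m %[mod d])%Z.
Proof.
move=> de; apply/eqP; rewrite eqz_mod_dvd {2}(divz_eq m e).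
by rewrite opprD addrCA subrr addr0 rpredN dvdz_mull.
Qed.

Lemma padic_prod_lift (f : forall p, prime p -> nat -> int) :
  (forall p (pp : prime p) n, (f p pp n.+1 = f p pp n %[mod (p ^ n)%N])%Z) ->
  exists a : padic_prod, forall p (pp : prime p) n,
    (padic_res (a p pp) n = f p pp n %[mod (p ^ n)%N])%Z.
Proof.
move=> fP; pose r p pp n := `|(f p pp n %% (p ^ n)%N)%Z|%N.
have pn0 p n : prime p -> (p ^ n)%N != 0 :> int.
  by move=> pp; rewrite eqz_nat -lt0n expn_gt0 prime_gt0.
have rE p pp n : r p pp n = (f p pp n %% (p ^ n)%N)%Z :> int.
  by rewrite /r gez0_abs // modz_ge0 // pn0.
have rP p pp n : r p pp n = (r p pp n.+1 %% p ^ n)%N.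
  apply/eqP; rewrite -eqz_nat -modz_nat !rE modz_dvdm ?fP //.
  exact: dvdn_exp2l.
exists (fun p pp => Padic (rP p pp)) => p pp n /=.
by rewrite rE modz_mod.
Qed.

(** [c] represents the family [a] modulo [N]: it acts as [a] does on the elements
    killed by [N]. The condition is inherited by the divisors of [N]. *)
Definition padic_cong (a : padic_prod) (N c : nat) : Prop :=
  forall p (pp : prime p) k, (p ^ k %| N)%N ->
    (c = padic_res (a p pp) k %[mod p ^ k])%N.

Lemma padic_cong_dvd a N M c : (M %| N)%N -> padic_cong a N c -> padic_cong a M c.
Proof. by move=> MN aP p pp k pM; apply: aP; apply: dvdn_trans MN. Qed.

Lemma padic_cong_unique a N c c' : (0 < N)%N ->
  padic_cong a N c -> padic_cong a N c' -> (c = c' %[mod N])%N.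
Proof.
move=> N0; wlog le : c c' / (c <= c')%N => [wl cP cP'|cP cP'].
  by case/orP: (leq_total c c') => le; [|symmetry]; apply: wl.
apply/esym/eqP; rewrite eqn_mod_dvd //; apply/(dvdn_partP _ N0) => p.
rewrite mem_primes => /and3P[pp _ _]; rewrite p_part -eqn_mod_dvd //.
by rewrite (cP _ pp) ?(cP' _ pp) ?pfactor_dvdnn.
Qed.

(** Chinese remaindering over the primary factors of [N]. *)
Lemma exists_padic_cong a N : (0 < N)%N -> exists c, padic_cong a N c.
Proof.
elim/ltn_ind: N => N IH N0.
have [N1|N1] := leqP N 1.
  exists 0%N => p pp k; have -> : N = 1%N by apply/eqP; rewrite eqn_leq N1.
  by rewrite dvdn1 => /eqP ->; rewrite !modn1.
move: (pdiv N) (pdiv_prime N1) (pdiv_dvd N) => p pp pN.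
have [m pm NE] := pfactor_coprime pp N0; set k := logn p N in NE.
have k0 : (0 < k)%N by rewrite logn_gt0 mem_primes pp N0.
have m0 : (0 < m)%N by move: N0; rewrite NE muln_gt0 => /andP[].
have [||c cP] := IH m => //.
  by rewrite NE ltn_Pmulr // -(expn0 p) ltn_exp2l // prime_gt1.
have co : coprime m (p ^ k) by rewrite coprime_sym coprimeXl.
exists (chinese m (p ^ k) c (padic_res (a p pp) k)) => q qp j qN.
have [qE|qNp] := eqVneq q p.
  move: qp qN; rewrite {q}qE => qp; rewrite (bool_irrelevance qp pp) => qN.
  have jk : (j <= k)%N by rewrite /k -pfactor_dvdn.
  have pjk : (p ^ j %| p ^ k)%N by exact: dvdn_exp2l.
  rewrite -(padic_res_le _ jk) -(modn_dvdm _ pjk) chinese_modr //.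
  by rewrite modn_dvdm.
have qm : (q ^ j %| m)%N.
  move: qN; rewrite NE Gauss_dvdl // coprimeXl // coprimeXr //.
  by rewrite prime_coprime // dvdn_prime2.
by rewrite -(modn_dvdm _ qm) chinese_modl // modn_dvdm // cP.
Qed.

End Padic.

Section PadicAction.
Variable A : zmodType.
Implicit Types (phi psi alpha : endo A) (x y z : A) (a b : padic_prod)
  (H : zmodClosed A).

Lemma mulrn_eqmod N c c' x : x *+ N = 0 -> (c = c' %[mod N])%N -> x *+ c = x *+ c'.
Proof.
move=> xN cc; rewrite (divn_eq c N) (divn_eq c' N) cc !mulrnDr.
by rewrite ![(_ * N)%N]mulnC !mulrnA xN !mul0rn.
Qed.

Lemma acts_padic_cong a phi N c x : acts_padic a phi -> (0 < N)%N ->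
  padic_cong a N c -> x *+ N = 0 -> phi x = x *+ c.
Proof.
move=> phia N0 cP; move: x; apply: primary_ind => //.
- by rewrite raddf0 mul0rn.
- by move=> x y xE yE; rewrite raddfD mulrnDl xE yE.
move=> p k x pp pN xk xN; have xg := mulrn_gcd0 xk xN.
have /(dvdn_pfactor _ _ pp)[j jk dE] : (gcdn (p ^ k) N %| p ^ k)%N.
  exact: dvdn_gcdl.
rewrite dE in xg; rewrite (phia _ pp _ _ xg); apply: mulrn_eqmod xg _.
by rewrite (cP _ pp) // -dE dvdn_gcdr.
Qed.

Lemma exists_acts_padic a : periodic A -> exists alpha, acts_padic a alpha.
Proof.
move=> perA; have [||| alpha alphaP] := @exists_endo A (fun x y =>
    exists N c, [/\ (0 < N)%N, padic_cong a N c, x *+ N = 0 & y = x *+ c]).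
- move=> x; have [N N0 xN] := perA x; have [c cP] := exists_padic_cong a N0.
  by exists (x *+ c), N, c.
- move=> x y z [N [c [N0 cP xN ->]]] [M [d [M0 dP xM ->]]].
  have g0 : (0 < gcdn N M)%N by rewrite gcdn_gt0 N0.
  apply: mulrn_eqmod (mulrn_gcd0 xN xM) _; apply: padic_cong_unique g0 _ _.
    exact: padic_cong_dvd (dvdn_gcdl _ _) cP.
  exact: padic_cong_dvd (dvdn_gcdr _ _) dP.
- move=> x y x' y' [N [c [N0 cP xN ->]]] [M [d [M0 dP xM ->]]].
  have NM0 : (0 < N * M)%N by rewrite muln_gt0 N0.
  have [e eP] := exists_padic_cong a NM0.
  exists (N * M)%N, e; split=> //.
    by rewrite mulrnBl {1}mulrnA xN mulnC mulrnA xM !mul0rn subrr.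
  rewrite mulrnBl; congr (_ - _).
    apply: mulrn_eqmod xN _; apply: padic_cong_unique N0 cP _.
    by apply: padic_cong_dvd eP; rewrite dvdn_mulr.
  apply: mulrn_eqmod xM _; apply: padic_cong_unique M0 dP _.
  by apply: padic_cong_dvd eP; rewrite dvdn_mull.
exists alpha => p pp n x xn; have [N [c [N0 cP xN ->]]] := alphaP x.
have g0 : (0 < gcdn (p ^ n) N)%N by rewrite gcdn_gt0 N0 orbT.
have /(dvdn_pfactor _ _ pp)[j jk dE] : (gcdn (p ^ n) N %| p ^ n)%N.
  exact: dvdn_gcdl.
have := mulrn_gcd0 xn xN; rewrite dE => xj; apply: mulrn_eqmod xj _.
by rewrite (cP _ pp) ?(padic_res_le _ jk) // -dE dvdn_gcdr.
Qed.

(** On each element [a] acts as an integer. *)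
Lemma acts_padic_subgroup a alpha H : periodic A -> acts_padic a alpha ->
  forall x, x \in H -> alpha x \in H.
Proof.
move=> perA alphaa x xH; have [N N0 xN] := perA x.
have [c cP] := exists_padic_cong a N0.
by rewrite (acts_padic_cong alphaa N0 cP) // rpredMn.
Qed.

End PadicAction.

Section AlmostPadic.
Variable A : zmodType.
Implicit Types (phi psi alpha beta : endo A) (x y z : A) (a b : padic_prod)
  (H : zmodClosed A).

Definition almost_padic phi : Prop :=
  exists2 alpha, (exists a, acts_padic a alpha) & phi - alpha \in finitary A.

(** The kernel of [phi - alpha] has finite index. *)
Lemma almost_padic_MF phi : periodic A -> almost_padic phi -> prop_MF phi.
Proof.
move=> perA [alpha [a alphaa] fin]; have [H HP] := exists_kernel (phi - alpha).
have phiE x : x \in H -> phi x = alpha x.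
  by move=> /HP/eqP; rewrite endoBE subr_eq0 => /eqP.
have phiH x : x \in H -> phi x \in H.
  by move=> xH; rewrite phiE //; apply: acts_padic_subgroup alphaa _ xH.
have [psi psiP] := exists_restriction phiH.
exists H.
  apply: (finite_index_of_map ((finitaryP _).1 fin)) => x y xy; apply/HP.
  by rewrite raddfB xy subrr.
exists psi => //; left; split=> [[x xH]|].
  by have [N N0 xN] := perA x; exists N => //; apply: val_inj; rewrite raddfMn.
exists a => p pp n u un; apply: val_inj; rewrite raddfMn psiP.
rewrite phiE ?(valP u) // (alphaa _ pp n) // -raddfMn un raddf0 //.
Qed.

(** The image of [phi - alpha] is finite. An element of the quotient killed by
    [p ^ n] lifts to some [x] killed by some [N] only; an integer representing
    [a] modulo [p ^ n * N] acts correctly on both. *)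
Lemma almost_padic_FM phi : periodic A -> almost_padic phi -> prop_FM phi.
Proof.
move=> perA [alpha [a alphaa] fin].
have [||H HP] := @exists_subgroup A (range (phi - alpha)).
- by exists 0; rewrite ?raddf0.
- by move=> _ _ [x _ <-] [y _ <-]; exists (x - y); rewrite ?raddfB.
have phiE x : phi x - alpha x \in H by apply/HP; exists x.
have phiH x : x \in H -> phi x \in H.
  move=> xH; rewrite -(subrK (alpha x) (phi x)) rpredD //.
  exact: acts_padic_subgroup alphaa _ xH.
have [psi psiP] := exists_induced phiH.
exists H; first by apply: sub_finite_set ((finitaryP _).1 fin) => x /HP.
exists psi => //; left; split=> [x|].
  have [N N0 xN] := perA (repr x); exists N => //.
  by rewrite -[x]reprK -raddfMn xN raddf0.
exists a => p pp n u un; have [N N0 xN] := perA (repr u).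
have pN0 : (0 < p ^ n * N)%N by rewrite muln_gt0 expn_gt0 prime_gt0.
have [c cP] := exists_padic_cong a pN0.
have -> : u *+ padic_res (a p pp) n = u *+ c.
  have : (c = padic_res (a p pp) n %[mod p ^ n])%N by apply: cP; rewrite dvdn_mulr.
  set r := padic_res _ _ => cr; rewrite (divn_eq c (p ^ n)) (divn_eq r (p ^ n)) cr.
  by rewrite !mulrnDr ![(_ * p ^ n)%N]mulnC !mulrnA un !mul0rn.
rewrite -[u]reprK psiP -raddfMn; apply/eq_quotP.
rewrite -(acts_padic_cong alphaa pN0 cP) //.
by rewrite mulnC mulrnA xN mul0rn.
Qed.

Lemma MF_almost_padic phi : periodic A -> prop_MF phi -> almost_padic phi.
Proof.
move=> perA [H finH [psi psiP [[_ [a psia]]|[nper _]]]]; last first.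
  case: nper => [[x xH]]; have [N N0 xN] := perA x; exists N => //.
  by apply: val_inj; rewrite raddfMn.
have [alpha alphaa] := exists_acts_padic a perA.
exists alpha; first by exists a.
apply: (finitary_of_finite_index finH) => x xH.
have [N N0 xN] := perA x; have [c cP] := exists_padic_cong a N0.
have /(congr1 val) : psi (Sub x xH) = Sub x xH *+ c.
  by apply: (acts_padic_cong psia N0 cP); apply: val_inj; rewrite raddfMn.
rewrite psiP raddfMn /= => e.
by rewrite e (acts_padic_cong alphaa N0 cP xN) subrr.
Qed.

Lemma FM_almost_padic phi : periodic A -> prop_FM phi -> almost_padic phi.
Proof.
move=> perA [H finH [psi psiP [[_ [a psia]]|[nper _]]]]; last first.
  case: nper => u; have [N N0 xN] := perA (repr u); exists N => //.
  by rewrite -[u]reprK -raddfMn xN raddf0.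
have [alpha alphaa] := exists_acts_padic a perA.
exists alpha; first by exists a.
apply/finitaryP; apply: sub_finite_set finH => _ [x _ <-].
have [N N0 xN] := perA x; have [c cP] := exists_padic_cong a N0.
rewrite endoBE (acts_padic_cong alphaa N0 cP xN); apply/eq_quotP.
rewrite -psiP (acts_padic_cong psia N0 cP) ?raddfMn //.
by rewrite -raddfMn xN raddf0.
Qed.

(** * The ring of multiplications of a periodic group *)

Lemma acts_padicE a alpha : acts_padic a alpha <->
  forall p (pp : prime p) n x, x *+ (p ^ n) = 0 ->
    alpha x = x *~ (padic_res (a p pp) n : int).
Proof. by split=> aP p pp n x xn; rewrite (aP p pp n x xn) -?pmulrn. Qed.

(** The integers [f p pp n] need not be reduced modulo [p ^ n], so that one can
    do arithmetic with p-adic residues. *)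
Lemma exists_padic_int (f : forall p, prime p -> nat -> int) alpha :
  (forall p (pp : prime p) n, (f p pp n.+1 = f p pp n %[mod (p ^ n)%N])%Z) ->
  (forall p (pp : prime p) n x, x *+ (p ^ n) = 0 -> alpha x = x *~ f p pp n) ->
  exists a, acts_padic a alpha.
Proof.
move=> fP alphaf; have [a aP] := padic_prod_lift fP.
exists a; apply/acts_padicE => p pp n x xn.
by rewrite (alphaf p pp n x xn); apply: mulrz_eqmod xn _.
Qed.

Lemma padic_res_eqz p (a : padic p) n :
  (padic_res a n.+1 = padic_res a n %[mod (p ^ n)%N])%Z.
Proof. by rewrite !modz_nat (padic_res_le _ (leqnSn n)). Qed.

Lemma acts_padic_int (m : int) : exists a, acts_padic a (m%:~R : endo A).
Proof.
by apply: (@exists_padic_int (fun _ _ _ => m)) => // p pp n x _; rewrite endo_intE.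
Qed.

Lemma acts_padicB a b alpha beta : acts_padic a alpha -> acts_padic b beta ->
  exists c, acts_padic c (alpha - beta).
Proof.
move=> /acts_padicE aP /acts_padicE bP.
apply: (@exists_padic_int
  (fun p pp n => Posz (padic_res (a p pp) n) - Posz (padic_res (b p pp) n))).
  move=> p pp n; rewrite -modzDml padic_res_eqz modzDml.
  by rewrite -modzDmr -modzNm padic_res_eqz modzNm modzDmr.
by move=> p pp n x xn; rewrite endoBE (aP p pp n) // (bP p pp n) // mulrzBr.
Qed.

Lemma acts_padicM a b alpha beta : acts_padic a alpha -> acts_padic b beta ->
  exists c, acts_padic c (alpha * beta).
Proof.
move=> /acts_padicE aP /acts_padicE bP.
apply: (@exists_padic_int
  (fun p pp n => Posz (padic_res (b p pp) n) * Posz (padic_res (a p pp) n))).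
  move=> p pp n; rewrite -modzMml padic_res_eqz modzMml.
  by rewrite -modzMmr padic_res_eqz modzMmr.
move=> p pp n x xn; rewrite endoME (bP p pp n) // (aP p pp n).
  by rewrite mulrzA.
by rewrite mulrznAC xn mul0rz.
Qed.

End AlmostPadic.

(** * The ring [FM(A)] *)

Section FMRing.
Variable A : zmodType.
Implicit Types (phi psi : endo A) (x y : A) (q : rat).

Lemma FM_slopeP phi : ~ periodic A -> FM_ring A phi <-> exists q, slope phi q.
Proof.
by move=> nper; split=> [|[q phiq]]; [exact: slope_of_MF|exact: slope_MF phiq].
Qed.

Lemma FM_almost_padicP phi : periodic A -> FM_ring A phi <-> almost_padic phi.
Proof.
by move=> per; split; [exact: MF_almost_padic|exact: almost_padic_MF].
Qed.

Lemma MF_iff_FM phi : prop_MF phi <-> prop_FM phi.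
Proof.
have [per|nper] := pselect (periodic A).
  split=> [/(MF_almost_padic per)|/(FM_almost_padic per)].
    exact: almost_padic_FM.
  exact: almost_padic_MF.
split=> [/(slope_of_MF nper)|/(slope_of_FM nper)] [q phiq].
  exact: slope_FM phiq.
exact: slope_MF phiq.
Qed.

(** With [phi = m / n] and [psi = m' / n'] up to finitary endomorphisms, the
    difference and the product are represented by the usual fractions; in the
    periodic case use differences and products of p-adic actions. Finitary
    endomorphisms form an ideal. *)
Lemma FM_ring_subring : GRing.subring_closed (mem (FM_ring A)).
Proof.
have mE phi : (phi \in mem (FM_ring A)) <-> FM_ring A phi.
  by split=> [/set_mem|/mem_set].
have [per|nper] := pselect (periodic A).
  have mP phi : (phi \in mem (FM_ring A)) <-> almost_padic phi.
    by rewrite mE; apply: FM_almost_padicP.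
  split=> [|phi psi /mP[alpha [a aP] fin] /mP[beta [b bP] fin']
           |phi psi /mP[alpha [a aP] fin] /mP[beta [b bP] fin']]; apply/mP.
  - by exists 1; rewrite ?subrr ?rpred0 //; apply: (acts_padic_int A 1).
  - exists (alpha - beta); first exact: acts_padicB aP bP.
    have -> : phi - psi - (alpha - beta) = phi - alpha - (psi - beta).
      by rewrite !opprD !opprK addrACA.
    exact: rpredB.
  - exists (alpha * beta); first exact: acts_padicM aP bP.
    have -> : phi * psi - alpha * beta = (phi - alpha) * psi + alpha * (psi - beta).
      by rewrite mulrBl mulrBr addrA subrK.
    by apply: rpredD; [exact: finitaryMr|exact: finitaryMl].
have mP phi : (phi \in mem (FM_ring A)) <-> exists q, slope phi q.
  by rewrite mE; apply: FM_slopeP.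
have frac m n phi : almost_frac phi m n -> phi \in mem (FM_ring A).
  by move=> /slope_frac phiq; apply/mP; eexists; apply: phiq.
split=> [|phi psi /mP[q phiq] /mP[q' psiq]|phi psi /mP[q phiq] /mP[q' psiq]].
- exact: frac (almost_frac_int A 1).
- exact: frac (almost_fracB phiq psiq).
- exact: frac (almost_fracM phiq psiq).
Qed.

Lemma FM_ring_sum :
  FM_ring A = [set f + g | f in [set` finitary A] & g in quasi_mults A].
Proof.
apply/seteqP; split=> [phi FMphi|_ [f fin [g gQ <-]]].
  have [per|nper] := pselect (periodic A).
    have [alpha [a aP] fin] := (FM_almost_padicP phi per).1 FMphi.
    exists (phi - alpha) => //; exists alpha; last by rewrite subrK.
    by left; split=> //; left; split=> //; exists a.
  have [q /slope_quasi_mult[pi [psi [psiq fin]]]] := (FM_slopeP phi nper).1 FMphi.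
  exists (phi - psi) => //; exists psi; last by rewrite subrK.
  by right; split=> //; exists pi, 0, q.
case: gQ => [[per [[_ [a aP]]|[nper _]]]|[nper [pi [r [q gq]]]]].
- apply/FM_almost_padicP => //; exists g; first by exists a.
  by rewrite addrK.
- by case: nper.
- apply/FM_slopeP => //; exists q.
  apply: almost_frac_finitary (quasi_mult_slope gq).
  by rewrite opprD addrCA subrr addr0 rpredN.
Qed.

Section NonPeriodic.
Hypothesis nper : ~ periodic A.

Lemma slope_unique phi q q' : slope phi q -> slope phi q' -> q = q'.
Proof.
move=> phiq phiq'; have := almost_frac_unique nper phiq phiq'.
rewrite !absz_denq => e.
rewrite -[q]divq_num_den -[q']divq_num_den; apply/eqP.
by rewrite eqr_div ?intr_eq0 ?denq_neq0 // -!intrM e.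
Qed.

Lemma denq_absz q : (`|denq q|%N)%:R = (denq q)%:~R :> rat.
Proof. by rewrite pmulrn absz_denq. Qed.

Lemma slopeB phi psi q q' : slope phi q -> slope psi q' -> slope (phi - psi) (q - q').
Proof.
move=> phiq psiq; have := slope_frac (almost_fracB phiq psiq).
rewrite natrM !absz_denq intrB !intrM !denq_absz.
suff -> : (numq q)%:~R * (denq q')%:~R - (numq q')%:~R * (denq q)%:~R =
  (q - q') * ((denq q)%:~R * (denq q')%:~R) :> rat.
  by rewrite mulfK // mulf_neq0 ?intr_eq0 ?denq_neq0.
rewrite -{3}[q]divq_num_den -{3}[q']divq_num_den.
by field; rewrite !intr_eq0 !denq_neq0.
Qed.

Lemma slopeM phi psi q q' : slope phi q -> slope psi q' -> slope (phi * psi) (q * q').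
Proof.
move=> phiq psiq; have := slope_frac (almost_fracM phiq psiq).
by rewrite natrM intrM !denq_absz -mulf_div !divq_num_den.
Qed.

Lemma slope0_finitary phi : slope phi 0 <-> phi \in finitary A.
Proof.
by rewrite /slope /almost_frac /= mulr1n subr0; split=> [[]|] //; split=> //; apply: pi_number1.
Qed.

(** The slope is the isomorphism: it is well defined and injective because slope
    [0] means finitary, and [0 (+)_pi q] has slope [q]. *)
Lemma FM_mod_finitary_iso : exists f : {quot finitary A} -> rat,
  [/\ quot_ring_iso (FM_ring A) (Qloc (pi0 A)) f,
      f (\pi_{quot finitary A} 1) = 1
    & forall pi r q phi, quasi_mult pi r q phi -> f (\pi_{quot finitary A} phi) = q].
Proof.
pose f (u : {quot finitary A}) := xget 0 [set q | slope (repr u) q].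
have fP phi q : slope phi q -> f (\pi_{quot finitary A} phi) = q.
  move=> phiq; have rq : slope (repr (\pi_{quot finitary A} phi)) q.
    apply: almost_frac_finitary phiq.
    by apply/eq_quotP; rewrite reprK.
  by apply: xget_unique => // q' rq'; apply: slope_unique rq' rq.
have FMP phi : FM_ring A phi -> exists q, slope phi q by move/FM_slopeP; apply.
exists f; split=> [||pi r q phi /quasi_mult_slope/fP //].
  split=> [|phi psi /FMP[q phiq] /FMP[q' psiq]|phi psi /FMP[q phiq] /FMP[q' psiq]].
  - split=> [_ [phi /FMP[q phiq] <-]||q qpi].
    + by rewrite /= (fP _ _ phiq); case: phiq.
    + move=> _ _ /set_mem[phi /FMP[q phiq] <-] /set_mem[psi /FMP[q' psiq] <-].
      rewrite (fP _ _ phiq) (fP _ _ psiq) => qq'; apply/eq_quotP.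
      by apply/slope0_finitary; rewrite -(subrr q) {2}qq'; apply: slopeB.
    + have qpi' := qpi; have [d0 dP] := qpi.
      have fin_pi : finite_set [set p | p \in primes `|denq q|%N].
        exact: finite_seq.
      have [||phi phiP] := @exists_quasi_mult A _ 0 q fin_pi.
      * by move=> p; rewrite /= mem_primes => /and3P[pp _]; apply: dP.
      * by split=> // p pp pd; rewrite /= mem_primes pp d0.
      have phiq := quasi_mult_slope phiP.
      exists (\pi_{quot finitary A} phi); last exact: fP.
      by exists phi => //; apply/FM_slopeP => //; exists q.
  - rewrite (fP _ _ phiq) (fP _ _ psiq); apply: fP.
    rewrite -[psi]opprK -[q']opprK; apply: slopeB => //.
    rewrite -[- psi]sub0r -[- q']sub0r; apply: slopeB => //.
    by apply/slope0_finitary; apply: rpred0.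
  - by rewrite (fP _ _ phiq) (fP _ _ psiq); apply: fP; apply: slopeM.
apply: fP; have := slope_frac (almost_frac_int A 1); rewrite divr1.
by [].
Qed.

(** A finitary endomorphism has slope [0], and [r (+)_pi q] has slope [q]. *)
Lemma finitary_quasi_mults : [set` finitary A] `&` quasi_mults A =
  [set phi | exists pi r, quasi_mult pi r 0 phi].
Proof.
apply/seteqP; split=> [phi [fin [[per]//|[_ [pi [r [q phiq]]]]]]|phi [pi [r phi0]]].
  exists pi, r; suff <- : q = 0 by [].
  apply: slope_unique (quasi_mult_slope phiq) _.
  exact/slope0_finitary.
split; first exact: quasi_mult0_finitary phi0.
by right; split=> //; exists pi, r, 0.
Qed.

End NonPeriodic.
End FMRing.

(** * Inertiality *)

Section Inertial.
Variable A : zmodType.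
Implicit Types (phi : endo A) (x y t : A) (s : seq A) (p n r : nat)
  (H : zmodClosed A) (c : nat -> int).

Definition zcomb s c : A := \sum_(0 <= i < size s) s`_i *~ c i.

(** When [W] is a subgroup containing the [p]-multiples of the entries of [s],
    this is linear independence over the field with [p] elements, in the
    quotient by [W]. *)
Definition pindep p (W : set A) s : Prop :=
  forall c, W (zcomb s c) -> forall i, (i < size s)%N -> (p %| c i)%Z.

(** Modulo this subgroup, [H] is a vector space over the field with [p] elements,
    and the torsion-free rank of [A] bounds its dimension. *)
Definition p_radical p H : set A :=
  [set x | exists h t,
     [/\ h \in H, t \in H, t \in component A [set p] & x = h *+ p + t]].

Lemma zcomb_mem s c H : {subset s <= H} -> zcomb s c \in H.
Proof.
move=> sH; rewrite /zcomb big_nat; apply: rpred_sum => i /andP[_ si].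
by rewrite rpredMz // sH // mem_nth.
Qed.

Lemma zcombMz s c (m : int) : zcomb s c *~ m = zcomb s (fun i => c i * m).
Proof. by rewrite /zcomb mulrz_suml; apply: eq_bigr => i _; rewrite mulrzA. Qed.

Lemma torsion_mulrn x n : (0 < n)%N -> x *+ n \in torsion A -> x \in torsion A.
Proof.
move=> n0 /componentP[m [m0 _] xm]; apply/componentP; exists (n * m)%N.
  by split=> //; rewrite muln_gt0 n0.
by rewrite mulrnA.
Qed.

(** Infinite descent. A multiple by an integer [m] prime to [p] turns a relation
    modulo torsion into one modulo [H_p]; hence [p] divides all the coefficients,
    and dividing them by [p] gives another relation modulo torsion. *)
Lemma pindep_torsion_free p H s c j : prime p -> {subset s <= H} ->
  pindep p (p_radical p H) s -> zcomb s c \in torsion A ->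
  (j < size s)%N -> c j = 0.
Proof.
move=> pp sH ind tor js; move: {2}`|c j|.+1 (ltnSn `|c j|) => b.
elim: b c tor => // b IH c tor; rewrite ltnS => cb.
have pc i : (i < size s)%N -> (p %| c i)%Z.
  have [M [M0 _] sM] := (componentP _ _).1 tor.
  have [m pm ME] := pfactor_coprime pp M0.
  move=> si; have : (p %| c i * m)%Z.
    apply: (ind (fun i => c i * m)) => //; rewrite -zcombMz -pmulrn.
    exists 0, (zcomb s c *+ m); rewrite mul0rn add0r rpred0 rpredMn ?zcomb_mem //.
    split=> //; apply/(component_primeP _ pp).
    by exists (logn p M); rewrite -mulrnA -ME.
  by rewrite Gauss_dvdzl.
apply: contrapT => cj0.
suff : (c j %/ p)%Z = 0.
  by move=> cp0; apply: cj0; rewrite -(divzK (pc j js)) cp0 mul0r.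
apply: (IH (fun i => (c i %/ p)%Z)).
  apply: (@torsion_mulrn _ p); first exact: prime_gt0.
  rewrite pmulrn zcombMz; suff -> : zcomb s (fun i => (c i %/ p)%Z * p) = zcomb s c by [].
  by apply: eq_big_nat => i /andP[_ si]; rewrite divzK ?pc.
apply: leq_trans cb; rewrite -{2}(divzK (pc j js)) abszM ltn_Pmulr ?prime_gt1 //.
rewrite absz_gt0; apply/eqP => cp0; apply: cj0.
by rewrite -(divzK (pc j js)) cp0 mul0r.
Qed.

Lemma pindep_size p H s r :
  (forall u : seq {quot torsion A}, lin_indep u -> (size u <= r)%N) ->
  prime p -> {subset s <= H} -> pindep p (p_radical p H) s -> (size s <= r)%N.
Proof.
move=> rank pp sH ind.
have sE := size_map (fun x => \pi_{quot torsion A} x) s.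
rewrite -sE; apply: rank => d d0 i.
pose c k := oapp d 0 (insub k).
have <- : c i = d i by rewrite /c valK.
apply: (@pindep_torsion_free p H s) => //; last first.
  by rewrite -sE; apply: ltn_ord.
apply/quot_eq0P; rewrite -d0 raddf_sum -[in LHS]sE big_mkord.
apply: eq_bigr => k _; rewrite raddfMz /c valK /= (nth_map 0) //.
by rewrite -sE; apply: ltn_ord.
Qed.

(** [H / p H] is finite: its quotient by the image of [H_p] is spanned by a
    maximal [p]-independent family. *)
Lemma finite_mod_prime p H : finite_torsionfree_rank A -> prime p ->
  finite_set [set` component A [set p]] ->
  exists2 S : set A, finite_set S &
    forall x, x \in H -> exists y h, [/\ S y, y \in H, h \in H & x = y + h *+ p].
Proof.
move=> [r rank] pp finp.
pose P k := `[< exists s, [/\ {subset s <= H}, pindep p (p_radical p H) s & size s = k] >].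
have exP : exists k, P k by exists 0%N; apply/asboolP; exists [::]; split.
have bP k : P k -> (k <= r)%N.
  by move=> /asboolP[s [sH ind <-]]; apply: pindep_size ind.
have [_ /asboolP[s [sH ind <-]] max] := ex_maxnP exP bP.
pose S : set A := [set t + \sum_(i < size s) s`_i *+ g i
  | t in [set` component A [set p]] & g in [set: {ffun 'I_(size s) -> 'I_p.+1}]].
have finS : finite_set S by apply: finite_image2.
exists S => // x xH.
pose Q := exists c h t,
  [/\ h \in H, t \in H, t \in component A [set p] & x = t + zcomb s c + h *+ p].
suff [c [h [t [hH tH tp xE]]]] : Q.
  pose y := t + zcomb s (fun i => (c i %% p)%Z).
  exists y, (zcomb s (fun i => (c i %/ p)%Z) + h); split.
  - exists t => //; exists [ffun i => inord `|(c (val i) %% p)%Z|] => //.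
    rewrite /y /zcomb big_mkord; congr (_ + _); apply: eq_bigr => i _.
    have p0 : p != 0 :> int by rewrite eqz_nat -lt0n prime_gt0.
    rewrite ffunE inordK.
      by rewrite pmulrn gez0_abs // modz_ge0.
    by rewrite ltnS ltnW // -ltz_nat gez0_abs ?modz_ge0 // ltz_pmod // ltz_nat prime_gt0.
  - by rewrite rpredD // zcomb_mem.
  - by rewrite rpredD // zcomb_mem.
  - have cE : zcomb s c
        = zcomb s (fun i => (c i %% p)%Z) + zcomb s (fun i => (c i %/ p)%Z) *+ p.
      rewrite [_ *+ p]pmulrn zcombMz /zcomb -big_split /=.
      by apply: eq_bigr => i _; rewrite -mulrzDr addrC -divz_eq.
    by rewrite xE cE mulrnDl !addrA.
(* Otherwise [x :: s] would be p-independent, against the choice of [s]. *)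
apply: contrapT => nQ.
suff /max : P (size s).+1 by rewrite ltnn.
apply/asboolP; exists (x :: s); split=> // [y|c].
  by rewrite inE => /orP[/eqP ->|/sH].
rewrite /zcomb /= big_nat_recl //= -/(zcomb s (fun i => c i.+1)).
set z := zcomb _ _ => -[h [t [hH tH tp e]]].
have p0 : (p %| c 0%N)%Z.
  apply: contrapT => /negP npc; apply: nQ.
  have /coprimezP[[u v] /= uv] : coprimez (c 0%N) p.
    by rewrite coprimezE coprime_sym prime_coprime.
  exists (fun i => c i.+1 * - u), (h *~ u + x *~ v), (t *~ u).
  rewrite rpredD ?rpredMz //; split=> //.
  have xE : x *~ c 0%N = h *+ p + t - z by rewrite -e addrK.
  transitivity (x *~ c 0%N *~ u + x *+ p *~ v).
    by rewrite [x *+ p]pmulrn -!mulrzA -mulrzDr ![_ * u]mulrC [_ * v]mulrC uv.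
  rewrite xE -zcombMz -/z mulrNz mulrzBl mulrzDl mulrnDl !mulrznAC.
  by rewrite [h *+ p *~ u + _]addrC -!addrA [h *+ p *~ u + _]addrCA.
have /dvdzP[d dE] := p0.
case=> [//|i] si; apply: (ind (fun i => c i.+1)) => //.
exists (h - x *~ d), t; rewrite rpredB ?rpredMz //; split=> //.
apply: (@addrI _ (x *~ c 0%N)); rewrite e dE mulrzA -pmulrn mulrnBl !mulrznAC.
by rewrite addrA addrCA subrr addr0.
Qed.

Lemma finite_mod n H : finite_torsionfree_rank A -> pi_number (pi0 A) n ->
  exists2 S : set A, finite_set S &
    forall x, x \in H -> exists y h, [/\ S y, y \in H, h \in H & x = y + h *+ n].
Proof.
move=> rank; move: n; apply: pi_number_ind => [|p n pp [_ finp _] [S finS SP]].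
  exists [set 0] => // x xH; exists 0, x; split=> //; first exact: rpred0.
  by rewrite add0r mulr1n.
have [T finT TP] := finite_mod_prime H rank pp finp.
exists [set y + z *+ p | y in T & z in S]; first exact: finite_image2.
move=> x /TP[y [h [Ty yH /SP[z [k [Sz zH kH ->]]] ->]]].
exists (y + z *+ p), k; split=> //; first by exists y => //; exists z.
  by rewrite rpredD ?rpredMn.
by rewrite mulrnDl -mulrnA [(n * p)%N]mulnC addrA.
Qed.

(** In the non-periodic case write [phi *+ n = m + theta] with [theta]
    finitary; modulo [H], [phi (y + h *+ n)] is [phi y + theta h]. *)
Lemma FM_inertial phi : finite_torsionfree_rank A -> FM_ring A phi -> inertial A phi.
Proof.
move=> rank FMphi H.
suff [F finF FP] : exists2 F : set {quot H}, finite_set F &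
    forall y, y \in H -> F (\pi_{quot H} (phi y)).
  apply: sub_finite_set finF => _ [_ [x xH [y yH <-]] <-].
  have -> : \pi_{quot H} (x + phi y) = \pi_{quot H} (phi y).
    by apply/eq_quotP; rewrite addrK.
  exact: FP.
have [per|nper] := pselect (periodic A).
  have [alpha [a aP] /finitaryP fin] := (FM_almost_padicP phi per).1 FMphi.
  exists ((fun x => \pi_{quot H} x) @` range (phi - alpha)).
    exact: finite_image.
  move=> y yH; exists (phi y - alpha y); first by exists y.
  by apply/eq_quotP; rewrite addrAC subrr add0r rpredN; apply: acts_padic_subgroup aP _ yH.
have [q [npi fin]] := (FM_slopeP phi nper).1 FMphi.
have [S finS SP] := finite_mod H rank npi.
set n := absz _ in npi fin SP; set m := numq q in fin; set theta := _ - _ in fin.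
exists [set \pi_{quot H} (phi s + t) | s in S & t in range theta].
  by apply: finite_image2 => //; apply/finitaryP.
move=> _ /SP[y [h [Sy yH hH ->]]]; exists y => //; exists (theta h); first by exists h.
apply/eq_quotP; rewrite almost_fracE raddfD raddfMn opprD addrACA subrr.
rewrite add0r addrAC subrr add0r.
by rewrite rpredN rpredMz.
Qed.

End Inertial.

(** * Finitary multiplications of p-groups *)

Section PGroup.
Variables (A : zmodType) (p : nat).
Hypotheses (pp : prime p) (pA : p_group p A).
Implicit Types (phi : endo A) (x : A) (e n : nat).

Lemma p_group_periodic : periodic A.
Proof.
by move=> x; have [n xn] := pA x; exists (p ^ n)%N; rewrite // expn_gt0 prime_gt0.
Qed.

Lemma p_group_quasi_mults : quasi_mults A = mults A.
Proof.
apply/seteqP; split=> phi; last by left; split=> //; apply: p_group_periodic.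
by case=> [[]|[/(_ p_group_periodic)]].
Qed.

(** If [a A] is finite, then [p ^ k a] kills [A] for some [k]. An unbounded group
    has elements of order [p ^ j] with [j > n + k]; thus [p ^ (j - k)], and all
    the more [p ^ n], divides [a], for every [n]. *)
Lemma unbounded_finitary_mults : ~ (exists e, bound_by p A e) ->
  [set` finitary A] `&` mults A = [set 0].
Proof.
move=> unbdd; apply/seteqP; split=> [phi [fin]|_ ->]; last first.
  split; first exact: rpred0.
  left; split; [exact: p_group_periodic | exact: (acts_padic_int A 0)].
case=> [[_ [a aP]]|[/(_ p_group_periodic)]] //.
have [M M0 phiM] := finitary_exponent fin.
set r := padic_res (a p pp) in aP *.
have phir n x : x *+ (p ^ n) = 0 -> phi x = x *+ padic_res (a p pp) n.
  exact: aP.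
pose k := logn p M.
have rk0 n : padic_res (a p pp) n = 0%N.
  have [x xn] : exists x, x *+ (p ^ (n + k)) <> 0.
    apply: contrapT => nx; apply: unbdd; exists (n + k)%N => x.
    by apply: contrapT => xn; apply: nx; exists x.
  have [N xN] := pA x.
  have xrM : x *+ (padic_res (a p pp) N * M) = 0 by rewrite mulrnA -phir.
  have := mulrn_gcd0 xrM xN.
  have /(dvdn_pfactor _ _ pp)[j jN dE] :
      (gcdn (padic_res (a p pp) N * M) (p ^ N) %| p ^ N)%N by exact: dvdn_gcdr.
  rewrite dE => xj.
  have jk : (n + k < j)%N.
    rewrite ltnNge; apply/negP => /(dvdn_exp2l p)/dvdnP[i iE]; apply: xn.
    by rewrite iE mulnC mulrnA xj mul0rn.
  have : (p ^ j %| padic_res (a p pp) N * M)%N by rewrite -dE dvdn_gcdl.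
  have [m pm ME] := pfactor_coprime pp M0; rewrite -/k in ME.
  have jE : j = (j - k + k)%N by rewrite subnK // ltnW // (leq_trans _ jk) // ltnS leq_addl.
  rewrite ME mulnA jE expnD dvdn_pmul2r ?expn_gt0 ?prime_gt0 //.
  rewrite Gauss_dvdl ?coprimeXl // => rj.
  have njk : (n <= j - k)%N by rewrite -(leq_add2r k) -jE ltnW.
  have rn : (p ^ n %| padic_res (a p pp) N)%N by apply: dvdn_trans rj; apply: dvdn_exp2l.
  have nN : (n <= N)%N by apply: leq_trans njk (leq_trans (leq_subr _ _) jN).
  have := padic_res_le (a p pp) nN; rewrite (eqP rn).
  by case: (a p pp) => s sP /= s0; rewrite sP -modn_mod -sP -s0.
apply: endoP => x; have [n xn] := pA x.
by rewrite (phir n) // rk0.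
Qed.

Section Bounded.
Variables (e eps : nat).
Hypotheses (eP : least (bound_by p A) e) (epsP : least (ess_bound_by p A) eps).

(** Bezout: [p ^ g] is the greatest common divisor of [k] and [p ^ e], and
    [p ^ e] kills [A]. Hence [k] and [p ^ g] kill the same elements and have the
    same image. *)
Lemma int_gcd_pX (k : int) : exists2 g, (g <= e)%N &
  (Posz (p ^ g) %| k)%Z /\ exists u, forall x, x *+ (p ^ g) = x *~ k *~ u.
Proof.
have /(dvdn_pfactor _ _ pp)[g ge gE] : (gcdn `|k| (p ^ e) %| p ^ e)%N.
  exact: dvdn_gcdr.
exists g => //; have gcdE : gcdz k (p ^ e)%N = (p ^ g)%N by rewrite /gcdz gE.
split; first by rewrite -gcdE dvdz_gcdl.
have [u [v uv]] := Bezoutz k (p ^ e)%N; rewrite gcdE in uv.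
exists u => x; rewrite pmulrn -uv mulrzDr [u * _]mulrC [v * _]mulrC !mulrzA.
by rewrite -[x *~ (p ^ e)%N]pmulrn eP.1 mul0rz addr0.
Qed.

Lemma intmul_eq0 (k : int) : (forall x, x *~ k = 0) -> (Posz (p ^ e) %| k)%Z.
Proof.
move=> k0; have [g ge [gk [u uP]]] := int_gcd_pX k.
suff -> : e = g by [].
apply/eqP; rewrite eqn_leq ge andbT; apply: eP.2 => x.
by rewrite uP k0 mul0rz.
Qed.

Lemma intmul_finitary (k : int) :
  (k%:~R : endo A) \in finitary A <-> (Posz (p ^ eps) %| k)%Z.
Proof.
split=> [fin|/dvdzP[i ->]].
  have [g ge [gk [u uP]]] := int_gcd_pX k.
  apply: dvdz_trans gk; apply: dvdn_exp2l; apply: epsP.2.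
  apply: sub_finite_set (finite_image (fun y => y *~ u) ((finitaryP _).1 fin)).
  move=> _ [x _ <-]; exists (x *~ k); last by rewrite uP.
  by exists x; rewrite ?endo_intE.
rewrite intrM; apply: finitaryMl; apply/finitaryP.
apply: sub_finite_set epsP.1 => _ [x _ <-]; exists x => //.
by rewrite endo_intE -pmulrn.
Qed.

(** Send the class of [k] to the multiplication by [k]. On the whole of [A] a
    p-adic integer acts as its residue modulo [p ^ e], whence surjectivity. *)
Lemma bounded_finitary_mults :
  exists f : {quot multiples (p ^ e)%N} -> endo A,
    quot_ring_iso [set` multiples (p ^ eps)%N] ([set` finitary A] `&` mults A) f /\
    forall k : int, k \in multiples (p ^ eps)%N ->
      forall x, f (\pi_{quot multiples (p ^ e)%N} k) x = x *~ k.
Proof.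
pose f (u : {quot multiples (p ^ e)%N}) : endo A := (repr u)%:~R.
have fE k : f (\pi_{quot multiples (p ^ e)%N} k) = k%:~R.
  apply: endoP => x; rewrite !endo_intE; apply/eqP; rewrite -subr_eq0 -mulrzBr.
  have /dvdzP[i ->] : (Posz (p ^ e) %| repr (\pi_{quot multiples (p ^ e)%N} k) - k)%Z.
    by apply/eq_quotP; rewrite reprK.
  by rewrite mulrC mulrzA -pmulrn eP.1 mul0rz.
exists f; split=> [|k _ x]; last by rewrite fE endo_intE.
split=> [|k l _ _|k l _ _]; rewrite ?fE ?intrD ?intrM //.
split=> [_ [k kP <-]||phi [fin phiM]].
- rewrite /= fE; split; first exact/intmul_finitary.
  left; split; [exact: p_group_periodic | exact: acts_padic_int].
- move=> _ _ /set_mem[k _ <-] /set_mem[l _ <-]; rewrite !fE => kl.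
  apply/eq_quotP; apply: intmul_eq0 => x.
  by rewrite mulrzBr -(endo_intE k) kl endo_intE subrr.
- case: phiM => [[_ [a aP]]|[/(_ p_group_periodic)]] //.
  have phiE : phi = (Posz (padic_res (a p pp) e))%:~R.
    apply: endoP => x; rewrite endo_intE -pmulrn; apply: aP; exact: eP.1.
  exists (\pi_{quot multiples (p ^ e)%N} (Posz (padic_res (a p pp) e))).
    exists (Posz (padic_res (a p pp) e)) => //.
    by apply/intmul_finitary; rewrite -phiE.
  by rewrite fE.
Qed.

End Bounded.
End PGroup.

Theorem theorem3 (A : zmodType) :
  (forall phi : endo A, prop_MF phi <-> prop_FM phi) /\
  [/\ GRing.subring_closed (mem (FM_ring A)),
      FM_ring A = [set f + g | f in [set` finitary A] & g in quasi_mults A]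
    & finite_torsionfree_rank A -> FM_ring A `<=` inertial A] /\
  (~ periodic A ->
     (exists f : {quot finitary A} -> rat,
        [/\ quot_ring_iso (FM_ring A) (Qloc (pi0 A)) f,
            f (\pi_{quot finitary A} 1) = 1
          & forall pi r q (phi : endo A), quasi_mult pi r q phi ->
              f (\pi_{quot finitary A} phi) = q]) /\
     [set` finitary A] `&` quasi_mults A =
       [set phi | exists pi r, quasi_mult pi r 0 phi]) /\
  (forall p, prime p -> p_group p A ->
     [/\ quasi_mults A = mults A,
         ~ (exists e, bound_by p A e) -> [set` finitary A] `&` mults A = [set 0]
       & forall e eps, least (bound_by p A) e -> least (ess_bound_by p A) eps ->
           exists f : {quot multiples (p ^ e)%N} -> endo A,
             quot_ring_iso [set` multiples (p ^ eps)%N]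
               ([set` finitary A] `&` mults A) f /\
             forall k : int, k \in multiples (p ^ eps)%N ->
               forall x : A, f (\pi_{quot multiples (p ^ e)%N} k) x = x *~ k]).
Proof.
split; first exact: MF_iff_FM.
split.
  split; [exact: FM_ring_subring|exact: FM_ring_sum|].
  by move=> rank phi; apply: FM_inertial.
split=> [nper|p pp pA].
  by split; [exact: FM_mod_finitary_iso|exact: finitary_quasi_mults].
split; [exact: p_group_quasi_mults pA|exact: unbounded_finitary_mults pA|].
by move=> e eps eP epsP; apply: bounded_finitary_mults.
Qed.
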